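(* There exists a number $r_0=8.24639\ldots$ such that the function $$f(r)=\frac{1}{\pi}\mu(\psi^{-1}(r))-\frac{1}{r},\qquad r\in(0,\infty),$$ is strictly increasing in $(0,r_0)$ and decreasing in $(r_0,\infty)$, with the limiting value $f(\infty)=\lim_{r\to\infty}f(r)=0$. In particular, $$\frac{1}{\pi}\mu(\psi^{-1}(r))<\frac{1}{r}\quad\text{for } 0<r<1,\qquad\text{and}\qquad \frac{1}{\pi}\mu(\psi^{-1}(r))>\frac{1}{r}\quad\text{for } r>1.$$
   Context: For $0<r<1$ let $\mathcal{K}(r)=\int_0^{\pi/2}\frac{dt}{\sqrt{1-r^2\sin^2t}}$ and $\mathcal{E}(r)=\int_0^{\pi/2}\sqrt{1-r^2\sin^2t}\,dt$ be the complete elliptic integrals of the first and second kind (argument is the modulus $r$). Put $r'=\sqrt{1-r^2}$, $\mathcal{K}'(r)=\mathcal{K}(r')$, $\mathcal{E}'(r)=\mathcal{E}(r')$ (the prime on $\mathcal{K},\mathcal{E}$ is not a derivative). The function $\psi:(0,1)\to(0,\infty)$, $$\psi(r)=\frac{2(\mathcal{E}(r)-(1-r)\mathcal{K}(r))}{\mathcal{E}'(r)-r\mathcal{K}'(r)},$$ is an increasing homeomorphism of $(0,1)$ onto $(0,\infty)$, with inverse $\psi^{-1}:(0,\infty)\to(0,1)$. The function $\mu$ is defined on $(0,1)$ by $\mu(r)=\frac{\pi}{2}\frac{\mathcal{K}'(r)}{\mathcal{K}(r)}$. *)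

(* Defs.v *)
From Stdlib Require Export Reals ClassicalEpsilon.
From Coquelicot Require Export Coquelicot.
Open Scope R_scope.

(* The argument of the elliptic integrals is the modulus r, not the
   parameter m = r^2. *)
Definition ellK (r : R) : R :=
  RInt (fun t => 1 / sqrt (1 - r ^ 2 * (sin t) ^ 2)) 0 (PI / 2).

Definition ellE (r : R) : R :=
  RInt (fun t => sqrt (1 - r ^ 2 * (sin t) ^ 2)) 0 (PI / 2).

Definition cmod (r : R) : R := sqrt (1 - r ^ 2).

Definition ellK' (r : R) : R := ellK (cmod r).
Definition ellE' (r : R) : R := ellE (cmod r).

Definition psi (r : R) : R :=
  2 * (ellE r - (1 - r) * ellK r) / (ellE' r - r * ellK' r).

(* psi is a bijection of (0,1) onto (0,+oo), so for y > 0 this selects the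
   unique preimage of y in (0,1); the value for y <= 0 is irrelevant. *)
Definition psi_inv (y : R) : R :=
  epsilon (inhabits 0) (fun r => 0 < r < 1 /\ psi r = y).

Definition mu (r : R) : R := PI / 2 * (ellK' r / ellK r).

Definition f_mu (r : R) : R := 1 / PI * mu (psi_inv r) - 1 / r.

(* Main.v *)
Require Import Defs.
From Stdlib Require Import ssreflect Reals Ranalysis5 Lra.
From Coquelicot Require Import Coquelicot.
Open Scope R_scope.

(* Put N = E - (1-s)K and D = E' - sK', so psi = 2N/D. The derivatives of N and D collapse
   to E/(1+s) and (E'-K')/(1+s); hence psi increases, and with L = K'(E-K) + E'K > 0
   one gets for F(s) = f(psi(s)) = K'/(2K) - D/(2N)
     F'(s) = L (1-s) / (2 (1+s) N^2) * (1 - P(s)),   P = N^2 / ((1-s)^2 s K^2).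
   The derivative of P is a positive multiple of ((1+s)K - E) (2E - (1-s^2)K) > 0, so P
   takes the value 1 at a single s0 and F increases before s0 and decreases after it;
   r0 = psi(s0).
   Landen's transformation k -> 2 sqrt k / (1+k) halves K'/K, which gives K'/K -> 0 at
   s = 1; it maps (sqrt 2 - 1)^2 to the self-complementary modulus 1/sqrt 2, which gives
   F = 0 and psi = 1 there; and iterated it yields the bounds that locate s0 and r0. *)

(** * Derivatives of the complete elliptic integrals *)

(** The obstacle is the end s = 1, where K is unbounded. What happens there is read off D, which
    extends continuously to D(1) = 0 because the complementary modulus is 0 at that point, and off
    K'/K, whose smallness comes from iterating Landen's map. Landen's identities are themselves
    consequences of the derivative formulas: their right-hand sides solve the linear system
    satisfied by K and E and take the same values at modulus 0. F' factors because the derivatives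
    of K'/K and of D/N are both multiples of the Legendre combination L, so that the sign of F'
    rests on the single function P. The two sign claims about f then come from f(1) = 0 on one side
    of r0 and from decrease to the limit 0 on the other. In the numerical part pi drops out, since P
    and psi are homogeneous of degree 0 in the integrals: only rational bounds on E/K and K/(pi/2),
    at s and at s', are compared. *)

Lemma ell_radicand_lower (k t : R) :
  -1 < k < 1 -> 1 - k ^ 2 <= 1 - k ^ 2 * (sin t) ^ 2.
Proof.
intros Hk.
assert (H : 0 <= k ^ 2) by nra.
assert (Hs := SIN_bound t).
assert (0 <= 1 - sin t ^ 2) by nra.
nra.
Qed.

Lemma ell_radicand_pos (k t : R) :
  -1 < k < 1 -> 0 < 1 - k ^ 2 * (sin t) ^ 2.
Proof.
intros Hk; assert (H := ell_radicand_lower k t Hk); nra.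
Qed.

Lemma continuous_ellE_integrand (k t : R) :
  -1 < k < 1 -> continuous (fun t => sqrt (1 - k ^ 2 * sin t ^ 2)) t.
Proof.
intros Hk; apply: ex_derive_continuous; auto_derive.
exact (ell_radicand_pos k t Hk).
Qed.

Lemma continuous_ellK_integrand (k t : R) :
  -1 < k < 1 -> continuous (fun t => 1 / sqrt (1 - k ^ 2 * sin t ^ 2)) t.
Proof.
intros Hk; apply: ex_derive_continuous; auto_derive.
assert (HW := ell_radicand_pos k t Hk).
split; [exact HW | split; [apply Rgt_not_eq, sqrt_lt_R0, HW | exact I]].
Qed.

Lemma continuous_ell_cube_integrand (k t : R) :
  -1 < k < 1 ->
  continuous (fun t => 1 / ((1 - k ^ 2 * sin t ^ 2) *
    sqrt (1 - k ^ 2 * sin t ^ 2))) t.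
Proof.
intros Hk; apply: ex_derive_continuous; auto_derive.
assert (HW := ell_radicand_pos k t Hk).
split; [exact HW | split; [ | exact I]].
apply Rgt_not_eq, Rmult_lt_0_compat; [exact HW | apply sqrt_lt_R0, HW].
Qed.

Lemma ex_RInt_ell (f : R -> R) :
  (forall t, continuous f t) -> ex_RInt f 0 (PI / 2).
Proof. intros H; apply: ex_RInt_continuous; intros; apply H. Qed.

Lemma locally_modulus (k : R) : -1 < k < 1 -> locally k (fun x => -1 < x < 1).
Proof.
intros Hk.
apply (open_and (fun x => -1 < x) (fun x => x < 1));
  [apply open_gt | apply open_lt | exact Hk].
Qed.

Lemma continuity_2d_pt_radicand (k t : R) :
  continuity_2d_pt (fun u v => 1 - u ^ 2 * sin v ^ 2) k t.
Proof.
apply continuity_2d_pt_minus.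
  apply continuity_2d_pt_const.
apply continuity_2d_pt_mult.
  apply (continuity_1d_2d_pt_comp (fun x => x ^ 2) (fun u _ => u)).
    apply derivable_continuous_pt; reg.
  apply continuity_2d_pt_id1.
apply (continuity_1d_2d_pt_comp (fun x => sin x ^ 2) (fun _ v => v)).
  apply derivable_continuous_pt; reg.
apply continuity_2d_pt_id2.
Qed.

Lemma continuity_2d_pt_sqrt_radicand (k t : R) :
  -1 < k < 1 ->
  continuity_2d_pt (fun u v => sqrt (1 - u ^ 2 * sin v ^ 2)) k t.
Proof.
intros Hk.
apply (continuity_1d_2d_pt_comp sqrt (fun u v => 1 - u ^ 2 * sin v ^ 2)).
  apply continuity_pt_sqrt, Rlt_le, ell_radicand_pos, Hk.
apply continuity_2d_pt_radicand.
Qed.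

Lemma is_derive_ellE_integrand (k t : R) :
  -1 < k < 1 ->
  is_derive (fun k => sqrt (1 - k ^ 2 * sin t ^ 2)) k
    (- (k * sin t ^ 2) * / sqrt (1 - k ^ 2 * sin t ^ 2)).
Proof.
intros Hk; assert (HW := ell_radicand_pos k t Hk).
assert (Hs := sqrt_lt_R0 _ HW).
auto_derive; [exact HW | ].
replace (1 + - (k * (k * 1) * (sin t * (sin t * 1))))
  with (1 - k ^ 2 * sin t ^ 2) by ring.
field; lra.
Qed.

Lemma is_derive_ellK_integrand (k t : R) :
  -1 < k < 1 ->
  is_derive (fun k => 1 / sqrt (1 - k ^ 2 * sin t ^ 2)) k
    (k * sin t ^ 2 *
     / ((1 - k ^ 2 * sin t ^ 2) * sqrt (1 - k ^ 2 * sin t ^ 2))).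
Proof.
intros Hk; assert (HW := ell_radicand_pos k t Hk).
assert (Hs := sqrt_lt_R0 _ HW).
auto_derive; [repeat split; [exact HW | apply Rgt_not_eq, Hs] | ].
replace (1 + - (k * (k * 1) * (sin t * (sin t * 1))))
  with (1 - k ^ 2 * sin t ^ 2) by ring.
set (w := sqrt _) in *.
assert (Hw : 1 - k ^ 2 * sin t ^ 2 = w * w) by (symmetry; apply sqrt_sqrt; lra).
rewrite Hw; field; lra.
Qed.

(** Differentiation under the integral sign, shared by E and K. The range -1 < k < 1 includes k = 0,
    where continuity is needed later to anchor Landen's identities. *)
Lemma is_derive_RInt_ell (f df : R -> R -> R) (k : R) :
  -1 < k < 1 ->
  (forall x t, -1 < x < 1 -> is_derive (fun u => f u t) x (df x t)) ->
  (forall t, continuity_2d_pt df k t) ->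
  (forall x t, -1 < x < 1 -> continuous (f x) t) ->
  is_derive (fun x => RInt (f x) 0 (PI / 2)) k (RInt (df k) 0 (PI / 2)).
Proof.
intros Hk Hd Hc Hf.
assert (Hl := locally_modulus k Hk).
(* [is_derive_RInt_param] states its result through [Derive]; [df] is exchanged for it, here at [k]
   and below on a neighbourhood of [k]. *)
rewrite (RInt_ext (df k) (fun t => Derive (fun u => f u t) k)).
2: intros t _; symmetry; apply is_derive_unique, Hd, Hk.
apply (is_derive_RInt_param (fun u t => f u t)).
- apply: filter_imp Hl => x Hx t _; exists (df x t); apply Hd, Hx.
- intros t _.
  apply (continuity_2d_pt_ext_loc df); [ | apply Hc].
  destruct Hl as [d Hd'].
  exists d; intros u v Hu _.
  symmetry; apply is_derive_unique, Hd, Hd', Hu.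
- apply: filter_imp Hl => x Hx; apply ex_RInt_ell => t; apply Hf, Hx.
Qed.

Lemma is_derive_ellE_RInt (k : R) :
  -1 < k < 1 ->
  is_derive ellE k
    (RInt (fun t => - (k * sin t ^ 2) * / sqrt (1 - k ^ 2 * sin t ^ 2)) 0 (PI / 2)).
Proof.
intros Hk.
apply (is_derive_RInt_ell (fun k t => sqrt (1 - k ^ 2 * sin t ^ 2))
  (fun k t => - (k * sin t ^ 2) * / sqrt (1 - k ^ 2 * sin t ^ 2))); trivial.
- intros; apply is_derive_ellE_integrand; trivial.
- intros t.
  apply continuity_2d_pt_mult.
    apply continuity_2d_pt_opp, continuity_2d_pt_mult.
      apply continuity_2d_pt_id1.
    apply (continuity_1d_2d_pt_comp (fun x => sin x ^ 2) (fun _ v => v)).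
      apply derivable_continuous_pt; reg.
    apply continuity_2d_pt_id2.
  apply continuity_2d_pt_inv; [apply continuity_2d_pt_sqrt_radicand, Hk | ].
  apply Rgt_not_eq, sqrt_lt_R0, ell_radicand_pos, Hk.
- intros; apply continuous_ellE_integrand; trivial.
Qed.

Lemma is_derive_ellK_RInt (k : R) :
  -1 < k < 1 ->
  is_derive ellK k
    (RInt (fun t => k * sin t ^ 2 *
     / ((1 - k ^ 2 * sin t ^ 2) * sqrt (1 - k ^ 2 * sin t ^ 2))) 0 (PI / 2)).
Proof.
intros Hk.
apply (is_derive_RInt_ell (fun k t => 1 / sqrt (1 - k ^ 2 * sin t ^ 2))
  (fun k t => k * sin t ^ 2 *
     / ((1 - k ^ 2 * sin t ^ 2) * sqrt (1 - k ^ 2 * sin t ^ 2)))); trivial.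
- intros; apply is_derive_ellK_integrand; trivial.
- intros t.
  apply continuity_2d_pt_mult.
    apply continuity_2d_pt_mult.
      apply continuity_2d_pt_id1.
    apply (continuity_1d_2d_pt_comp (fun x => sin x ^ 2) (fun _ v => v)).
      apply derivable_continuous_pt; reg.
    apply continuity_2d_pt_id2.
  apply continuity_2d_pt_inv.
    apply continuity_2d_pt_mult.
      apply continuity_2d_pt_radicand.
    apply continuity_2d_pt_sqrt_radicand, Hk.
  apply Rgt_not_eq, Rmult_lt_0_compat; [ | apply sqrt_lt_R0];
    apply ell_radicand_pos, Hk.
- intros; apply continuous_ellK_integrand; trivial.
Qed.

Lemma is_RInt_ellE (k : R) :
  -1 < k < 1 ->
  is_RInt (fun t => sqrt (1 - k ^ 2 * sin t ^ 2)) 0 (PI / 2) (ellE k).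
Proof.
intros Hk; apply: RInt_correct; apply ex_RInt_ell => t.
apply continuous_ellE_integrand, Hk.
Qed.

Lemma is_RInt_ellK (k : R) :
  -1 < k < 1 ->
  is_RInt (fun t => 1 / sqrt (1 - k ^ 2 * sin t ^ 2)) 0 (PI / 2) (ellK k).
Proof.
intros Hk; apply: RInt_correct; apply ex_RInt_ell => t.
apply continuous_ellK_integrand, Hk.
Qed.

(** With Delta = sqrt(1 - k^2 sin^2 t), the integrand of dK/dk is (1/Delta^3 - 1/Delta)/k, so this
    integral is what expresses dK/dk through E and K. *)
Lemma is_RInt_ell_cube (k : R) :
  -1 < k < 1 ->
  is_RInt (fun t => 1 / ((1 - k ^ 2 * sin t ^ 2) * sqrt (1 - k ^ 2 * sin t ^ 2)))
    0 (PI / 2) (ellE k / (1 - k ^ 2)).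
Proof.
intros Hk.
assert (Hk2 : 0 < 1 - k ^ 2) by nra.
(* k^2 d/dt (sin t cos t / Delta) = Delta - (1 - k^2) / Delta^3 *)
assert (HD : is_RInt (fun t => sqrt (1 - k ^ 2 * sin t ^ 2) - (1 - k ^ 2) *
    (1 / ((1 - k ^ 2 * sin t ^ 2) * sqrt (1 - k ^ 2 * sin t ^ 2)))) 0 (PI / 2) 0).
{ set (F := fun t => k ^ 2 * (sin t * cos t / sqrt (1 - k ^ 2 * sin t ^ 2))).
  replace 0 with (minus (F (PI / 2)) (F 0)) at 2.
  2: { unfold F, minus, plus, opp; simpl; rewrite cos_PI2 sin_0.
       unfold Rdiv; ring. }
  apply (is_RInt_derive (V := R_CompleteNormedModule) F); intros t _.
  - assert (HW := ell_radicand_pos k t Hk).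
    assert (Hs := sqrt_lt_R0 _ HW).
    unfold F; auto_derive; [repeat split; [exact HW | apply Rgt_not_eq, Hs] | ].
    replace (1 + - (k * (k * 1) * (sin t * (sin t * 1))))
      with (1 - k ^ 2 * sin t ^ 2) by ring.
    set (w := sqrt _) in *.
    assert (Hw : 1 - k ^ 2 * sin t ^ 2 = w * w)
      by (symmetry; apply sqrt_sqrt; lra).
    assert (Hc : cos t * cos t = 1 - sin t ^ 2)
      by (assert (H := sin2_cos2 t); unfold Rsqr in H; nra).
    apply (Rmult_eq_reg_r (w ^ 3)); [ | apply Rgt_not_eq, pow_lt; lra].
    rewrite Hw; field_simplify; [ | lra | lra].
    replace (cos t ^ 2) with (1 - sin t ^ 2) by (rewrite <- Hc; ring).
    replace (w ^ 4) with ((1 - k ^ 2 * sin t ^ 2) ^ 2) by (rewrite Hw; ring).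
    replace (w ^ 2) with (1 - k ^ 2 * sin t ^ 2) by (rewrite Hw; ring).
    field.
  - apply: continuous_minus; [apply continuous_ellE_integrand, Hk | ].
    apply: continuous_scal_r; apply continuous_ell_cube_integrand, Hk. }
assert (H := is_RInt_scal _ _ _ (/ (1 - k ^ 2)) _
  (is_RInt_minus _ _ _ _ _ _ (is_RInt_ellE k Hk) HD)).
replace (ellE k / (1 - k ^ 2)) with (scal (/ (1 - k ^ 2)) (minus (ellE k) 0)).
2: { unfold scal, minus, plus, opp; simpl; unfold mult; simpl; field; lra. }
apply: is_RInt_ext H => t _.
unfold scal, minus, plus, opp; simpl; unfold mult; simpl.
assert (HW := ell_radicand_pos k t Hk).
assert (Hs := sqrt_lt_R0 _ HW).
simpl in HW, Hs; field; lra.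
Qed.

(** Since k^2 sin^2 t = 1 - Delta^2, the differentiated integrand is (Delta - 1/Delta)/k. *)
Lemma is_derive_ellE (k : R) :
  0 < k < 1 -> is_derive ellE k ((ellE k - ellK k) / k).
Proof.
intros Hk.
assert (Hk1 : -1 < k < 1) by lra.
rewrite <- (is_RInt_unique (fun t => - (k * sin t ^ 2) * / sqrt (1 - k ^ 2 * sin t ^ 2))
  0 (PI / 2) ((ellE k - ellK k) / k)).
  exact (is_derive_ellE_RInt k Hk1).
assert (H := is_RInt_scal _ _ _ (/ k) _
  (is_RInt_minus _ _ _ _ _ _ (is_RInt_ellE k Hk1) (is_RInt_ellK k Hk1))).
replace ((ellE k - ellK k) / k) with (scal (/ k) (minus (ellE k) (ellK k))).
2: { unfold scal, minus, plus, opp; simpl; unfold mult; simpl; field; lra. }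
apply: is_RInt_ext H => t _.
assert (HW := ell_radicand_pos k t Hk1).
assert (Hs := sqrt_lt_R0 _ HW).
unfold scal, minus, plus, opp; cbn -[pow]; unfold mult; cbn -[pow].
set (w := sqrt _) in *.
assert (Hw : 1 - k ^ 2 * sin t ^ 2 = w ^ 2) by (symmetry; apply pow2_sqrt; lra).
apply (Rmult_eq_reg_r (k * w)); [ | nra].
field_simplify; [ | lra | lra].
rewrite <- Hw; ring.
Qed.

Lemma is_derive_ellK (k : R) :
  0 < k < 1 ->
  is_derive ellK k ((ellE k - (1 - k ^ 2) * ellK k) / (k * (1 - k ^ 2))).
Proof.
intros Hk.
assert (Hk1 : -1 < k < 1) by lra.
assert (Hk2 : 0 < 1 - k ^ 2) by nra.
rewrite <- (is_RInt_unique (fun t => k * sin t ^ 2 *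
     / ((1 - k ^ 2 * sin t ^ 2) * sqrt (1 - k ^ 2 * sin t ^ 2)))
  0 (PI / 2) ((ellE k - (1 - k ^ 2) * ellK k) / (k * (1 - k ^ 2)))).
  exact (is_derive_ellK_RInt k Hk1).
assert (H := is_RInt_scal _ _ _ (/ k) _
  (is_RInt_minus _ _ _ _ _ _ (is_RInt_ell_cube k Hk1) (is_RInt_ellK k Hk1))).
replace ((ellE k - (1 - k ^ 2) * ellK k) / (k * (1 - k ^ 2)))
  with (scal (/ k) (minus (ellE k / (1 - k ^ 2)) (ellK k))).
2: { unfold scal, minus, plus, opp; cbn -[pow]; unfold mult; cbn -[pow]; field; lra. }
apply: is_RInt_ext H => t _.
assert (HW := ell_radicand_pos k t Hk1).
assert (Hs := sqrt_lt_R0 _ HW).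
unfold scal, minus, plus, opp; cbn -[pow]; unfold mult; cbn -[pow].
set (w := sqrt _) in *.
assert (Hw : 1 - k ^ 2 * sin t ^ 2 = w ^ 2) by (symmetry; apply pow2_sqrt; lra).
rewrite Hw.
apply (Rmult_eq_reg_r (k * w ^ 3)).
2: apply Rgt_not_eq, Rmult_lt_0_compat; [ | apply pow_lt]; lra.
field_simplify; [ | lra | lra].
rewrite <- Hw; ring.
Qed.

Lemma continuous_ellE (k : R) : -1 < k < 1 -> continuous ellE k.
Proof.
intros Hk; apply: ex_derive_continuous; eexists; apply is_derive_ellE_RInt, Hk.
Qed.

Lemma continuous_ellK (k : R) : -1 < k < 1 -> continuous ellK k.
Proof.
intros Hk; apply: ex_derive_continuous; eexists; apply is_derive_ellK_RInt, Hk.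
Qed.

(** * Values at modulus 0 and comparison of E, K and pi/2 *)

Lemma ellK_0 : ellK 0 = PI / 2.
Proof.
unfold ellK; rewrite (RInt_ext _ (fun _ => 1)).
  rewrite RInt_const; unfold scal; simpl; unfold mult; simpl; ring.
intros t _; replace (1 - 0 ^ 2 * sin t ^ 2) with 1 by ring.
rewrite sqrt_1; apply Rdiv_1_r.
Qed.

Lemma ellE_0 : ellE 0 = PI / 2.
Proof.
unfold ellE; rewrite (RInt_ext _ (fun _ => 1)).
  rewrite RInt_const; unfold scal; simpl; unfold mult; simpl; ring.
intros t _; replace (1 - 0 ^ 2 * sin t ^ 2) with 1 by ring.
apply sqrt_1.
Qed.

(** The integrands compare pointwise, because Delta^2 - (1 - k^2) = k^2 cos^2 t. The signs of N, D,
    L and of the derivative of P all rest on this inequality. *)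
Lemma ellE_gt_compl_ellK (k : R) : 0 < k < 1 -> (1 - k ^ 2) * ellK k < ellE k.
Proof.
intros Hk.
assert (Hk1 : -1 < k < 1) by lra.
assert (HPI := PI_RGT_0).
assert (Hint := is_RInt_scal _ _ _ (1 - k ^ 2) _ (is_RInt_ellK k Hk1)).
(* Rewrites the left side as one integral, so that [RInt_lt] can compare integrands. *)
refine (eq_rect _ (fun v => v < ellE k) _ _ (is_RInt_unique _ _ _ _ Hint)).
apply RInt_lt; [lra | | | ].
- intros; apply continuous_ellE_integrand, Hk1.
- intros; apply: continuous_scal_r; apply continuous_ellK_integrand, Hk1.
- intros t Ht; unfold scal; simpl; unfold mult; cbn -[pow].
  assert (HW := ell_radicand_pos k t Hk1).
  assert (Hs := sqrt_lt_R0 _ HW).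
  assert (Hc : 0 < cos t) by (apply cos_gt_0; lra).
  set (w := sqrt _) in *.
  assert (Hw : 1 - k ^ 2 * sin t ^ 2 = w ^ 2) by (symmetry; apply pow2_sqrt; lra).
  assert (Hsc : cos t ^ 2 = 1 - sin t ^ 2)
    by (assert (H := sin2_cos2 t); unfold Rsqr in H; nra).
  apply (Rmult_lt_reg_r w); [lra | ].
  apply (Rle_lt_trans _ (1 - k ^ 2)); [right; field; lra | ].
  assert (Hp : 0 < k ^ 2 * cos t ^ 2)
    by (apply Rmult_lt_0_compat; apply pow_lt; lra).
  rewrite Hsc in Hp; nra.
Qed.

Lemma ellE_lt_ellK (k : R) : 0 < k < 1 -> ellE k < ellK k.
Proof.
intros Hk.
assert (Hk1 : -1 < k < 1) by lra.
assert (HPI := PI_RGT_0).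
apply RInt_lt; [lra | | | ]; intros t Ht;
  [apply continuous_ellK_integrand, Hk1 | apply continuous_ellE_integrand, Hk1 | ].
assert (HW := ell_radicand_pos k t Hk1).
assert (Hs := sqrt_lt_R0 _ HW).
assert (Hc : 0 < sin t) by (apply sin_gt_0; lra).
set (w := sqrt _) in *.
assert (Hw : 1 - k ^ 2 * sin t ^ 2 = w ^ 2) by (symmetry; apply pow2_sqrt; lra).
apply (Rmult_lt_reg_r w); [lra | ].
replace (1 / w * w) with 1 by (field; lra).
assert (0 < k ^ 2 * sin t ^ 2) by (apply Rmult_lt_0_compat; apply pow_lt; lra).
nra.
Qed.

Lemma ellE_le_PI2 (k : R) : 0 < k < 1 -> ellE k <= PI / 2.
Proof.
intros Hk.
assert (Hk1 : -1 < k < 1) by lra.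
assert (HPI := PI_RGT_0).
rewrite <- ellE_0.
apply RInt_le; [lra | | | ].
- apply ex_RInt_ell => t; apply continuous_ellE_integrand, Hk1.
- apply ex_RInt_ell => t; apply continuous_ellE_integrand; lra.
- intros t _; apply sqrt_le_1_alt.
  assert (0 <= k ^ 2 * sin t ^ 2) by (apply Rmult_le_pos; apply pow2_ge_0).
  nra.
Qed.

Lemma ellK_ge_PI2 (k : R) : 0 < k < 1 -> PI / 2 <= ellK k.
Proof.
intros Hk.
assert (Hk1 : -1 < k < 1) by lra.
assert (HPI := PI_RGT_0).
rewrite <- ellK_0.
apply RInt_le; [lra | | | ].
- apply ex_RInt_ell => t; apply continuous_ellK_integrand; lra.
- apply ex_RInt_ell => t; apply continuous_ellK_integrand, Hk1.
- intros t _.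
  assert (HW := ell_radicand_pos k t Hk1).
  assert (0 <= k ^ 2 * sin t ^ 2) by (apply Rmult_le_pos; apply pow2_ge_0).
  unfold Rdiv; rewrite !Rmult_1_l.
  apply Rinv_le_contravar; [apply sqrt_lt_R0, HW | apply sqrt_le_1_alt; nra].
Qed.

(** * Landen's transformation *)

Lemma is_derive_eq (f : R -> R) (x d d' : R) :
  is_derive f x d -> d = d' -> is_derive f x d'.
Proof. intros H <-; exact H. Qed.

(** Only continuity is asked at 0, because [landen] contains a square root and is not differentiable
    there. *)
Lemma null_derivative_eq_0 (f : R -> R) (b x : R) :
  (forall z, 0 < z < b -> is_derive f z 0) -> continuous f 0 ->
  0 < x < b -> f x = f 0.
Proof.
intros Hd H0 Hx.
destruct (MVT_gen f 0 x (fun _ => 0)) as [c [_ Hc]]; [ | | lra];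
  rewrite Rmin_left ?Rmax_right; try lra.
- intros z Hz; apply Hd; lra.
- intros z Hz; apply continuity_pt_filterlim.
  destruct (Req_dec z 0) as [-> | Hz0]; [exact H0 | ].
  apply: ex_derive_continuous; exists 0; apply Hd; lra.
Qed.

Definition landen (k : R) : R := 2 * sqrt k / (1 + k).

Lemma landen_sq (k : R) : 0 <= k -> landen k ^ 2 = 4 * k / (1 + k) ^ 2.
Proof.
intros Hk; unfold landen, Rdiv.
rewrite !Rpow_mult_distr pow2_sqrt // pow_inv; ring.
Qed.

Lemma landen_range (k : R) : 0 < k < 1 -> 0 < landen k < 1.
Proof.
intros Hk; assert (Hs := sqrt_lt_R0 k (proj1 Hk)).
assert (Hs2 := pow2_sqrt k ltac:(lra)).
split.
- apply Rdiv_lt_0_compat; lra.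
- apply (Rmult_lt_reg_r (1 + k)); [lra | ].
  unfold landen; field_simplify; [ | lra].
  assert (sqrt k < 1) by (rewrite <- sqrt_1; apply sqrt_lt_1_alt; lra).
  nra.
Qed.

Lemma compl_landen (k : R) :
  0 < k < 1 -> cmod (landen k) = (1 - k) / (1 + k).
Proof.
intros Hk; unfold cmod; rewrite landen_sq; [ | lra].
replace (1 - 4 * k / (1 + k) ^ 2) with (((1 - k) / (1 + k)) ^ 2) by (field; lra).
apply sqrt_pow2, Rlt_le, Rdiv_lt_0_compat; lra.
Qed.

Lemma is_derive_landen (k : R) :
  0 < k < 1 -> is_derive landen k ((1 - k) / (sqrt k * (1 + k) ^ 2)).
Proof.
intros Hk; assert (Hs := sqrt_lt_R0 k (proj1 Hk)).
assert (Hs2 := pow2_sqrt k ltac:(lra)).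
unfold landen; auto_derive; [repeat split; lra | ].
set (s := sqrt k) in *; rewrite <- Hs2; field; split; nra.
Qed.

Lemma continuous_landen_0 : continuous landen 0.
Proof.
apply: continuous_mult.
  apply: continuous_scal_r; apply continuous_sqrt.
apply: ex_derive_continuous; auto_derive; lra.
Qed.

Lemma landen_0 : landen 0 = 0.
Proof. unfold landen; rewrite sqrt_0; field. Qed.

Lemma is_derive_ellE_landen (k : R) :
  0 < k < 1 ->
  is_derive (fun x => ellE (landen x)) k
    ((ellE (landen k) - ellK (landen k)) * (1 - k) / (2 * k * (1 + k))).
Proof.
intros Hk; assert (Hs := sqrt_lt_R0 k (proj1 Hk)).
assert (Hs2 := pow2_sqrt k ltac:(lra)).
assert (H := is_derive_comp ellE landen k _ _
  (is_derive_ellE _ (landen_range k Hk)) (is_derive_landen k Hk)).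
apply (is_derive_eq _ _ _ _ H).
change scal with Rmult.
set (e := ellE _); set (m := ellK _); unfold landen.
set (s := sqrt k) in *; rewrite <- Hs2; field; repeat split; nra.
Qed.

Lemma is_derive_ellK_landen (k : R) :
  0 < k < 1 ->
  is_derive (fun x => ellK (landen x)) k
    (((1 + k) ^ 2 * ellE (landen k) - (1 - k) ^ 2 * ellK (landen k)) /
     (2 * k * (1 + k) * (1 - k))).
Proof.
intros Hk; assert (Hs := sqrt_lt_R0 k (proj1 Hk)).
assert (Hs2 := pow2_sqrt k ltac:(lra)).
assert (H := is_derive_comp ellK landen k _ _
  (is_derive_ellK _ (landen_range k Hk)) (is_derive_landen k Hk)).
apply (is_derive_eq _ _ _ _ H).
change scal with Rmult.
rewrite landen_sq; [ | lra].
replace (1 - 4 * k / (1 + k) ^ 2) with (((1 - k) / (1 + k)) ^ 2) by (field; lra).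
set (e := ellE _); set (m := ellK _); unfold landen.
set (s := sqrt k) in *; rewrite <- Hs2; field; repeat split; nra.
Qed.

(** [landenK] and [landenE] are Landen's formulas solved for K(k) and E(k). The derivatives below
    show that this pair obeys the differential system of [ellK] and [ellE]; at 0 all four functions
    equal pi/2. *)
Definition landenK (k : R) : R := ellK (landen k) / (1 + k).
Definition landenE (k : R) : R :=
  ((1 + k) * ellE (landen k) + (1 - k) * ellK (landen k)) / 2.

Lemma is_derive_landenK (k : R) :
  0 < k < 1 ->
  is_derive landenK k
    ((landenE k - (1 - k ^ 2) * landenK k) / (k * (1 - k ^ 2))).
Proof.
intros Hk; assert (HK := is_derive_ellK_landen k Hk).
assert (H1 : is_derive (fun x => 1 + x) k 1) by (auto_derive; [ | ring]; trivial).
apply (is_derive_eq _ _ _ _ (is_derive_div _ _ k _ _ HK H1 ltac:(lra))).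
unfold landenE, landenK; field; repeat split; try lra; nra.
Qed.

Lemma is_derive_landenE (k : R) :
  0 < k < 1 -> is_derive landenE k ((landenE k - landenK k) / k).
Proof.
intros Hk; assert (HK := is_derive_ellK_landen k Hk).
assert (HE := is_derive_ellE_landen k Hk).
assert (H : forall (f g : R -> R) df dg, is_derive f k df -> is_derive g k dg ->
  is_derive (fun x => ((1 + x) * f x + (1 - x) * g x) / 2) k
    ((f k + (1 + k) * df - g k + (1 - k) * dg) / 2)).
{ intros f g df dg Hf Hg; auto_derive.
    repeat split; eexists; [apply Hf | apply Hg].
  rewrite (is_derive_unique (fun x => f x) _ _ Hf).
  rewrite (is_derive_unique (fun x => g x) _ _ Hg); field. }
apply (is_derive_eq _ _ _ _ (H _ _ _ _ HE HK)).
unfold landenE, landenK; field; lra.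
Qed.

Lemma continuous_ellK_landen_0 : continuous (fun x => ellK (landen x)) 0.
Proof.
apply (continuous_comp landen ellK); [apply continuous_landen_0 | ].
rewrite landen_0; apply continuous_ellK; lra.
Qed.

Lemma continuous_ellE_landen_0 : continuous (fun x => ellE (landen x)) 0.
Proof.
apply (continuous_comp landen ellE); [apply continuous_landen_0 | ].
rewrite landen_0; apply continuous_ellE; lra.
Qed.

Lemma continuous_landenK_0 : continuous landenK 0.
Proof.
apply: continuous_mult; [apply continuous_ellK_landen_0 | ].
apply: ex_derive_continuous; auto_derive; lra.
Qed.

Lemma continuous_landenE_0 : continuous landenE 0.
Proof.
apply (continuous_mult
  (fun k => (1 + k) * ellE (landen k) + (1 - k) * ellK (landen k)) (fun _ => / 2));
  [ | apply continuous_const].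
apply: continuous_plus; apply: continuous_mult;
  first [apply continuous_ellK_landen_0 | apply continuous_ellE_landen_0
        | apply: ex_derive_continuous; auto_derive; trivial].
Qed.

(* Both pairs solve the same first-order linear system, so their Wronskian is constant. *)
Lemma landen_wronskian (k : R) :
  0 < k < 1 -> landenK k * ellE k = landenE k * ellK k.
Proof.
intros Hk.
pose (w := fun k => landenK k * ellE k - landenE k * ellK k).
assert (Hw : w k = w 0).
{ apply (null_derivative_eq_0 w 1); [ | | exact Hk].
  - intros z Hz.
    assert (H1 := is_derive_landenK z Hz); assert (H2 := is_derive_landenE z Hz).
    assert (H3 := is_derive_ellK z Hz); assert (H4 := is_derive_ellE z Hz).
    unfold w; auto_derive.
      repeat split; eexists; [apply H1 | apply H4 | apply H2 | apply H3].
    rewrite (is_derive_unique _ _ _ H1) (is_derive_unique _ _ _ H2).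
    rewrite (is_derive_unique _ _ _ H3) (is_derive_unique _ _ _ H4).
    (* The cancellation reflects the zero trace of the system: its diagonal entries are -1/z and
       1/z. *)
    field; split; nra.
  - apply: continuous_minus; apply: continuous_mult.
    + apply continuous_landenK_0.
    + apply continuous_ellE; lra.
    + apply continuous_landenE_0.
    + apply continuous_ellK; lra. }
assert (H0 : w 0 = 0)
  by (unfold w, landenK, landenE; rewrite landen_0 ellK_0 ellE_0; field).
rewrite H0 in Hw; exact (Rminus_diag_uniq _ _ Hw).
Qed.

Lemma ellK_pos (k : R) : 0 < k < 1 -> 0 < ellK k.
Proof.
intros Hk; assert (H := ellK_ge_PI2 k Hk); assert (HPI := PI_RGT_0); lra.
Qed.

(** The vanishing Wronskian gives [landenE / landenK = ellE / ellK], so [landenK] and [ellK] have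
    the same logarithmic derivative. Their quotient is constant and equals 1 at 0. *)
Lemma landenK_eq (k : R) : 0 < k < 1 -> landenK k = ellK k.
Proof.
intros Hk.
pose (q := fun k => landenK k / ellK k).
assert (HPI := PI_RGT_0).
assert (Hq : q k = q 0).
{ apply (null_derivative_eq_0 q 1); [ | | exact Hk].
  - intros z Hz.
    assert (H1 := is_derive_landenK z Hz); assert (H3 := is_derive_ellK z Hz).
    assert (HK := ellK_pos z Hz).
    unfold q; auto_derive.
      repeat split; [eexists; apply H1 | eexists; apply H3 | lra].
    rewrite (is_derive_unique _ _ _ H1) (is_derive_unique _ _ _ H3).
    assert (HW := landen_wronskian z Hz).
    replace (landenE z) with (landenK z * ellE z / ellK z).
      field; repeat split; nra.
    rewrite HW; field; lra.
  - apply: continuous_mult; [apply continuous_landenK_0 | ].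
    apply (continuous_comp ellK Rinv); [apply continuous_ellK; lra | ].
    apply continuous_Rinv; rewrite ellK_0; lra. }
unfold q in Hq.
assert (HK := ellK_pos k Hk).
assert (H0 : landenK 0 / ellK 0 = 1)
  by (unfold landenK; rewrite landen_0 ellK_0; field; lra).
rewrite H0 in Hq.
replace (landenK k) with (landenK k / ellK k * ellK k) by (field; lra).
rewrite Hq; ring.
Qed.

Lemma landenE_eq (k : R) : 0 < k < 1 -> landenE k = ellE k.
Proof.
intros Hk; assert (HW := landen_wronskian k Hk); assert (HK := ellK_pos k Hk).
rewrite (landenK_eq k Hk) in HW; nra.
Qed.

Lemma ellK_landen (k : R) : 0 < k < 1 -> ellK (landen k) = (1 + k) * ellK k.
Proof.
intros Hk; rewrite <- (landenK_eq k Hk); unfold landenK; field; lra.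
Qed.

Lemma ellE_landen (k : R) :
  0 < k < 1 ->
  ellE (landen k) = (2 * ellE k - (1 - k ^ 2) * ellK k) / (1 + k).
Proof.
intros Hk; rewrite <- (landenK_eq k Hk), <- (landenE_eq k Hk).
unfold landenK, landenE; field; lra.
Qed.

(** * Monotonicity of psi and of f along psi *)

Lemma cmod_sq (k : R) : 0 < k < 1 -> cmod k ^ 2 = 1 - k ^ 2.
Proof. intros Hk; apply pow2_sqrt; nra. Qed.

Lemma cmod_range (k : R) : 0 < k < 1 -> 0 < cmod k < 1.
Proof.
intros Hk; assert (H := cmod_sq k Hk).
assert (0 < cmod k) by (apply sqrt_lt_R0; nra).
nra.
Qed.

Lemma is_derive_cmod (k : R) : 0 < k < 1 -> is_derive cmod k (- k / cmod k).
Proof.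
intros Hk; assert (H := cmod_range k Hk); unfold cmod in *.
auto_derive; [nra | ].
replace (1 + - (k * (k * 1))) with (1 - k ^ 2) by ring.
field; lra.
Qed.

Lemma is_derive_ellK' (k : R) :
  0 < k < 1 ->
  is_derive ellK' k (- (ellE' k - k ^ 2 * ellK' k) / (k * (1 - k ^ 2))).
Proof.
intros Hk; assert (Hc := cmod_range k Hk); assert (Hc2 := cmod_sq k Hk).
apply (is_derive_eq _ _ _ _ (is_derive_comp ellK cmod k _ _
  (is_derive_ellK _ Hc) (is_derive_cmod k Hk))).
change scal with Rmult; fold (ellE' k) (ellK' k).
set (c := cmod k) in *.
replace (1 - c ^ 2) with (k ^ 2) by lra.
rewrite <- Hc2; field; lra.
Qed.

Lemma is_derive_ellE' (k : R) :
  0 < k < 1 ->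
  is_derive ellE' k (k * (ellK' k - ellE' k) / (1 - k ^ 2)).
Proof.
intros Hk; assert (Hc := cmod_range k Hk); assert (Hc2 := cmod_sq k Hk).
apply (is_derive_eq _ _ _ _ (is_derive_comp ellE cmod k _ _
  (is_derive_ellE _ Hc) (is_derive_cmod k Hk))).
change scal with Rmult; fold (ellE' k) (ellK' k).
rewrite <- Hc2; field; lra.
Qed.

Lemma ellK'_pos (k : R) : 0 < k < 1 -> 0 < ellK' k.
Proof. intros Hk; apply ellK_pos, cmod_range, Hk. Qed.

Lemma ellE'_lt_ellK' (k : R) : 0 < k < 1 -> ellE' k < ellK' k.
Proof. intros Hk; apply ellE_lt_ellK, cmod_range, Hk. Qed.

Lemma ellE'_gt (k : R) : 0 < k < 1 -> k ^ 2 * ellK' k < ellE' k.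
Proof.
intros Hk; assert (H := ellE_gt_compl_ellK _ (cmod_range k Hk)).
rewrite (cmod_sq k Hk) in H.
replace (1 - (1 - k ^ 2)) with (k ^ 2) in H by ring; exact H.
Qed.

(* Equal to pi / 2 by Legendre's relation, but only its sign is needed. *)
Definition legendre (k : R) : R :=
  ellK' k * (ellE k - ellK k) + ellE' k * ellK k.

(** E > (1 - k^2) K bounds the first term below by -k^2 K K', and E' > k^2 K' bounds the second
    below by k^2 K K'. *)
Lemma legendre_pos (k : R) : 0 < k < 1 -> 0 < legendre k.
Proof.
intros Hk; unfold legendre.
assert (H1 := ellE'_gt k Hk); assert (H2 := ellE_gt_compl_ellK k Hk).
assert (H3 := ellK_pos k Hk); assert (H4 := ellK'_pos k Hk).
nra.
Qed.

(** Landen's map sends (1 - k)/(1 + k), the complement of [landen k], to k'. Applying the formulas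
    for K and E at that modulus therefore yields the ones for K' and E'. *)
Lemma landen_compl_landen (k : R) :
  0 < k < 1 -> landen (cmod (landen k)) = cmod k.
Proof.
intros Hk; rewrite (compl_landen k Hk).
assert (Hm : 0 < (1 - k) / (1 + k) < 1).
{ split; [apply Rdiv_lt_0_compat; lra | ].
  apply (Rmult_lt_reg_r (1 + k)); [lra | ].
  unfold Rdiv; rewrite Rmult_assoc Rinv_l; lra. }
assert (Hl := landen_range _ Hm); assert (Hl2 := landen_sq _ (Rlt_le _ _ (proj1 Hm))).
assert (Hc := cmod_range k Hk); assert (Hc2 := cmod_sq k Hk).
assert (H : landen ((1 - k) / (1 + k)) ^ 2 = cmod k ^ 2)
  by (rewrite Hl2 Hc2; field; lra).
nra.
Qed.

Lemma ellK'_landen (k : R) :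
  0 < k < 1 -> ellK' k = 2 / (1 + k) * ellK' (landen k).
Proof.
intros Hk; unfold ellK' at 1; rewrite <- (landen_compl_landen k Hk).
rewrite (ellK_landen _ (cmod_range _ (landen_range k Hk))).
fold (ellK' (landen k)); rewrite (compl_landen k Hk); field; lra.
Qed.

Lemma ellE'_landen (k : R) :
  0 < k < 1 ->
  ellE' k = (1 + k) * ellE' (landen k) - 2 * k / (1 + k) * ellK' (landen k).
Proof.
intros Hk; unfold ellE' at 1; rewrite <- (landen_compl_landen k Hk).
rewrite (ellE_landen _ (cmod_range _ (landen_range k Hk))).
fold (ellK' (landen k)) (ellE' (landen k)); rewrite (compl_landen k Hk); field; lra.
Qed.

(** * Numerator and denominator of psi, and its inverse *)

Definition psi_num (s : R) : R := ellE s - (1 - s) * ellK s.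
Definition psi_den (s : R) : R := ellE' s - s * ellK' s.

Lemma is_derive_psi_num (s : R) :
  0 < s < 1 -> is_derive psi_num s (ellE s / (1 + s)).
Proof.
intros Hs.
assert (H1 := is_derive_ellK s Hs); assert (H2 := is_derive_ellE s Hs).
assert (H : forall (f g : R -> R) d1 d2, is_derive f s d1 -> is_derive g s d2 ->
  is_derive (fun x => g x - (1 - x) * f x) s (d2 + f s - (1 - s) * d1)).
{ clear; intros f g d1 d2 H1 H2; auto_derive.
    repeat split; eexists; eassumption.
  rewrite (is_derive_unique (fun x => f x) _ _ H1).
  rewrite (is_derive_unique (fun x => g x) _ _ H2); ring. }
apply (is_derive_eq _ _ _ _ (H _ _ _ _ H1 H2)).
field; repeat split; nra.
Qed.

Lemma is_derive_psi_den (s : R) :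
  0 < s < 1 -> is_derive psi_den s ((ellE' s - ellK' s) / (1 + s)).
Proof.
intros Hs.
assert (H1 := is_derive_ellK' s Hs); assert (H2 := is_derive_ellE' s Hs).
assert (H : forall (f g : R -> R) d1 d2, is_derive f s d1 -> is_derive g s d2 ->
  is_derive (fun x => g x - x * f x) s (d2 - f s - s * d1)).
{ clear; intros f g d1 d2 H1 H2; auto_derive.
    repeat split; eexists; eassumption.
  rewrite (is_derive_unique (fun x => f x) _ _ H1).
  rewrite (is_derive_unique (fun x => g x) _ _ H2); ring. }
apply (is_derive_eq _ _ _ _ (H _ _ _ _ H1 H2)).
field; repeat split; nra.
Qed.

Lemma psi_num_pos (s : R) : 0 < s < 1 -> 0 < psi_num s.
Proof.
intros Hs; unfold psi_num.
assert (H1 := ellE_gt_compl_ellK s Hs); assert (H2 := ellK_pos s Hs).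
assert (0 < s * (1 - s) * ellK s) by (repeat apply Rmult_lt_0_compat; lra).
nra.
Qed.

(* psi_den s is 2 (E - k'^2 K) / (1 + k) at the modulus k whose Landen image is s'. *)
Lemma psi_den_pos (s : R) : 0 < s < 1 -> 0 < psi_den s.
Proof.
intros Hs; unfold psi_den.
rewrite (ellE'_landen s Hs) (ellK'_landen s Hs).
assert (H := ellE_gt_compl_ellK _ (cmod_range _ (landen_range s Hs))).
fold (ellK' (landen s)) (ellE' (landen s)) in H.
rewrite (compl_landen s Hs) in H.
replace (1 - ((1 - s) / (1 + s)) ^ 2) with (4 * s / (1 + s) ^ 2) in H by (field; lra).
apply (Rmult_lt_compat_l (1 + s)) in H; [ | lra].
apply Rlt_0_minus in H.
refine (Rlt_le_trans _ _ _ H _); right; field; lra.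
Qed.

(** Positivity is asked only inside the interval, since the derivative of [elliptic_gap] vanishes at
    s0, which occurs as an endpoint. *)
Lemma derive_pos_lt (f df : R -> R) (x y : R) :
  (forall z, x <= z <= y -> is_derive f z (df z)) ->
  (forall z, x < z < y -> 0 < df z) -> x < y -> f x < f y.
Proof.
intros Hd Hp Hxy.
destruct (MVT_cor2 f df x y Hxy) as [c [Hc Hxc]].
  intros z Hz; apply is_derive_Reals, Hd, Hz.
assert (0 < df c * (y - x)) by (apply Rmult_lt_0_compat; [apply Hp, Hxc | lra]).
lra.
Qed.

Lemma psi_num_incr (x y : R) : 0 < x -> x < y -> y < 1 -> psi_num x < psi_num y.
Proof.
intros Hx Hxy Hy; apply (derive_pos_lt psi_num (fun s => ellE s / (1 + s))); trivial;
  intros z Hz.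
  apply is_derive_psi_num; lra.
assert (Hz1 : 0 < z < 1) by lra.
assert (H := ellE_gt_compl_ellK z Hz1); assert (HK := ellK_pos z Hz1).
assert (0 < (1 - z ^ 2) * ellK z) by (apply Rmult_lt_0_compat; nra).
apply Rdiv_lt_0_compat; lra.
Qed.

Lemma psi_den_decr (x y : R) : 0 < x -> x < y -> y < 1 -> psi_den y < psi_den x.
Proof.
intros Hx Hxy Hy.
apply Ropp_lt_cancel.
apply (derive_pos_lt (fun s => - psi_den s)
  (fun s => - ((ellE' s - ellK' s) / (1 + s)))); trivial; intros z Hz.
  apply: is_derive_opp; apply is_derive_psi_den; lra.
assert (Hz1 : 0 < z < 1) by lra.
assert (H := ellE'_lt_ellK' z Hz1).
replace (- ((ellE' z - ellK' z) / (1 + z))) with ((ellK' z - ellE' z) / (1 + z))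
  by (field; lra).
apply Rdiv_lt_0_compat; lra.
Qed.

Lemma psi_eq (s : R) : psi s = 2 * psi_num s / psi_den s.
Proof. reflexivity. Qed.

Lemma psi_pos (s : R) : 0 < s < 1 -> 0 < psi s.
Proof.
intros Hs; assert (H1 := psi_num_pos s Hs); assert (H2 := psi_den_pos s Hs).
rewrite psi_eq; apply Rdiv_lt_0_compat; lra.
Qed.

Lemma psi_incr (x y : R) : 0 < x -> x < y -> y < 1 -> psi x < psi y.
Proof.
intros Hx Hxy Hy; rewrite !psi_eq.
assert (HNx := psi_num_pos x ltac:(lra)).
assert (HDy := psi_den_pos y ltac:(lra)).
assert (HN := psi_num_incr x y Hx Hxy Hy); assert (HD := psi_den_decr x y Hx Hxy Hy).
unfold Rdiv; apply Rmult_gt_0_lt_compat; try lra.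
- apply Rinv_0_lt_compat; lra.
- apply Rinv_lt_contravar; [apply Rmult_lt_0_compat | ]; lra.
Qed.

Lemma psi_lt_inv (x y : R) : 0 < x < 1 -> 0 < y < 1 -> psi x < psi y -> x < y.
Proof.
intros Hx Hy H; destruct (Rtotal_order x y) as [ | [-> | Hyx]]; trivial; [lra | ].
assert (H' := psi_incr y x ltac:(lra) Hyx ltac:(lra)); lra.
Qed.

Lemma continuous_psi_num (s : R) : -1 < s < 1 -> continuous psi_num s.
Proof.
intros Hs; apply: continuous_minus; [apply continuous_ellE, Hs | ].
apply: continuous_mult; [ | apply continuous_ellK, Hs].
apply: ex_derive_continuous; auto_derive; trivial.
Qed.

Lemma continuous_cmod (s : R) : -1 < s <= 1 -> continuous cmod s.
Proof.
intros Hs; apply continuity_pt_filterlim.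
apply (continuity_pt_comp (fun x => 1 - x ^ 2) sqrt).
  apply derivable_continuous_pt; reg.
(* At s = 1 the radicand is 0; [sqrt] is 0 on negative reals, hence continuous there from both
   sides. *)
apply continuity_pt_sqrt; nra.
Qed.

(** The endpoint s = 1 is within reach because [cmod 1] is 0, a point of continuity of E and K. *)
Lemma continuous_psi_den (s : R) : 0 < s <= 1 -> continuous psi_den s.
Proof.
intros Hs.
assert (Hc : -1 < cmod s < 1).
{ assert (H1 := sqrt_pos (1 - s ^ 2)).
  assert (H2 : sqrt (1 - s ^ 2) < 1)
    by (rewrite <- sqrt_1 at 2; apply sqrt_lt_1_alt; nra).
  unfold cmod; lra. }
assert (Hs1 : -1 < s <= 1) by lra.
apply: continuous_minus.
  apply (continuous_comp cmod ellE); [apply continuous_cmod | apply continuous_ellE];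
    trivial.
apply: continuous_mult; [apply continuous_id | ].
apply (continuous_comp cmod ellK); [apply continuous_cmod | apply continuous_ellK];
  trivial.
Qed.

Lemma continuous_psi (s : R) : 0 < s < 1 -> continuous psi s.
Proof.
intros Hs; assert (HD := psi_den_pos s Hs).
apply: continuous_mult.
  apply: continuous_scal_r; apply continuous_psi_num; lra.
apply (continuous_comp psi_den Rinv); [apply continuous_psi_den; lra | ].
apply continuous_Rinv; lra.
Qed.

Lemma psi_num_0 : psi_num 0 = 0.
Proof. unfold psi_num; rewrite ellE_0 ellK_0; ring. Qed.

Lemma psi_den_1 : psi_den 1 = 0.
Proof.
unfold psi_den, ellE', ellK', cmod.
replace (1 - 1 ^ 2) with 0 by ring; rewrite sqrt_0 ellE_0 ellK_0; ring.
Qed.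

Lemma continuous_eps (f : R -> R) (x e : R) :
  continuous f x -> 0 < e ->
  exists d, 0 < d /\ forall y, Rabs (y - x) < d -> Rabs (f y - f x) < e.
Proof.
intros Hf He.
destruct (proj1 (filterlim_locally f (f x)) Hf (mkposreal e He)) as [d Hd].
exists d; split; [apply cond_pos | exact Hd].
Qed.

Lemma psi_num_small (e : R) : 0 < e -> exists s, 0 < s <= 1 / 2 /\ psi_num s < e.
Proof.
intros He.
destruct (continuous_eps psi_num 0 e (continuous_psi_num 0 ltac:(lra)) He)
  as [d [Hd H]].
pose (s := Rmin (d / 2) (1 / 2)).
assert (Hs : 0 < s <= 1 / 2 /\ s <= d / 2).
{ unfold s; split; [split | apply Rmin_l]; [apply Rmin_glb_lt; lra | apply Rmin_r]. }
exists s; split; [lra | ].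
assert (Ha : Rabs (psi_num s - psi_num 0) < e)
  by (apply H; rewrite Rabs_pos_eq; lra).
rewrite psi_num_0 in Ha; apply Rabs_def2 in Ha; lra.
Qed.

Lemma psi_den_small (e : R) : 0 < e -> exists s, 1 / 2 <= s < 1 /\ psi_den s < e.
Proof.
intros He.
destruct (continuous_eps psi_den 1 e (continuous_psi_den 1 ltac:(lra)) He)
  as [d [Hd H]].
pose (s := 1 - Rmin (d / 2) (1 / 2)).
assert (Hs : 0 < 1 - s <= 1 / 2 /\ 1 - s <= d / 2).
{ unfold s.
  assert (H1 := Rmin_l (d / 2) (1 / 2)); assert (H2 := Rmin_r (d / 2) (1 / 2)).
  assert (H3 : 0 < Rmin (d / 2) (1 / 2)) by (apply Rmin_glb_lt; lra).
  lra. }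
exists s; split; [lra | ].
assert (Ha : Rabs (psi_den s - psi_den 1) < e)
  by (apply H; rewrite Rabs_minus_sym Rabs_pos_eq; lra).
rewrite psi_den_1 in Ha; apply Rabs_def2 in Ha; lra.
Qed.

(** With a <= 1/2 <= b, monotonicity gives psi a <= 2 N(a) / D(1/2) and psi b >= 2 N(1/2) / D(b).
    Small N(a) and small D(b) put r strictly between psi a and psi b. *)
Lemma psi_surjective (r : R) : 0 < r -> exists s, 0 < s < 1 /\ psi s = r.
Proof.
intros Hr.
assert (HD := psi_den_pos (1 / 2) ltac:(lra)).
assert (HN := psi_num_pos (1 / 2) ltac:(lra)).
destruct (psi_num_small (r * psi_den (1 / 2) / 2)) as [a [Ha Hla]].
  apply Rdiv_lt_0_compat; [apply Rmult_lt_0_compat | ]; lra.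
destruct (psi_den_small (2 * psi_num (1 / 2) / r)) as [b [Hb Hlb]].
  apply Rdiv_lt_0_compat; lra.
assert (HDa := psi_den_pos a ltac:(lra)); assert (HDb := psi_den_pos b ltac:(lra)).
assert (Ha1 : psi_den (1 / 2) <= psi_den a).
{ destruct (Req_dec a (1 / 2)) as [-> | ]; [lra | ].
  apply Rlt_le, psi_den_decr; lra. }
assert (Hb1 : psi_num (1 / 2) <= psi_num b).
{ destruct (Req_dec b (1 / 2)) as [-> | ]; [lra | ].
  apply Rlt_le, psi_num_incr; lra. }
assert (Hpa : psi a < r).
{ rewrite psi_eq; apply (Rmult_lt_reg_r (psi_den a)); [exact HDa | ].
  unfold Rdiv; rewrite Rmult_assoc Rinv_l; [nra | lra]. }
assert (Hpb : r < psi b).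
{ rewrite psi_eq; apply (Rmult_lt_reg_r (psi_den b)); [exact HDb | ].
  unfold Rdiv; rewrite Rmult_assoc Rinv_l; [ | lra].
  apply (Rmult_lt_compat_l r) in Hlb; [ | exact Hr].
  replace (r * (2 * psi_num (1 / 2) / r)) with (2 * psi_num (1 / 2)) in Hlb
    by (field; lra).
  lra. }
assert (Hab : a < b) by (apply psi_lt_inv; lra).
destruct (IVT_interv (fun x => psi x - r) a b) as [z [Hz Hz0]]; try lra.
  intros z Hz; apply continuity_pt_minus; [ | apply continuity_pt_const; easy].
  apply continuity_pt_filterlim, continuous_psi; lra.
exists z; lra.
Qed.

Lemma psi_inv_spec (r : R) : 0 < r -> 0 < psi_inv r < 1 /\ psi (psi_inv r) = r.
Proof.
intros Hr; unfold psi_inv; apply epsilon_spec, psi_surjective, Hr.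
Qed.

(** * The function f along psi and its critical modulus *)

Definition elliptic_gap (s : R) : R :=
  ellK' s / (2 * ellK s) - psi_den s / (2 * psi_num s).

(** The factor 1/pi cancels the pi in [mu], and 1/psi = D/(2N); [elliptic_gap] is the function F of
    the overview. *)
Lemma f_mu_eq (r : R) : 0 < r -> f_mu r = elliptic_gap (psi_inv r).
Proof.
intros Hr; destruct (psi_inv_spec r Hr) as [Hs Hp].
unfold f_mu; rewrite <- Hp at 2; rewrite psi_eq.
unfold elliptic_gap, mu.
assert (HPI := PI_RGT_0); assert (HK := ellK_pos _ Hs).
assert (HN := psi_num_pos _ Hs); assert (HD := psi_den_pos _ Hs).
field; repeat split; lra.
Qed.

Lemma psi_inv_incr (x y : R) : 0 < x -> x < y -> psi_inv x < psi_inv y.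
Proof.
intros Hx Hxy.
destruct (psi_inv_spec x Hx) as [H1 H2].
destruct (psi_inv_spec y ltac:(lra)) as [H3 H4].
apply psi_lt_inv; trivial; lra.
Qed.

Lemma psi_inv_psi (s : R) : 0 < s < 1 -> psi_inv (psi s) = s.
Proof.
intros Hs; destruct (psi_inv_spec _ (psi_pos s Hs)) as [H1 H2].
destruct (Rtotal_order (psi_inv (psi s)) s) as [H | [H | H]]; trivial.
- assert (H' := psi_incr _ _ (proj1 H1) H (proj2 Hs)); lra.
- assert (H' := psi_incr _ _ (proj1 Hs) H (proj2 H1)); lra.
Qed.

(* The derivative of [elliptic_gap] has the sign of [1 - gap_crit]. *)
Definition gap_crit (s : R) : R :=
  psi_num s ^ 2 / ((1 - s) ^ 2 * s * ellK s ^ 2).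

(** The derivative of K'/K is -L / (s (1 - s^2) K^2) and that of D/N is -(1 - s) L / ((1 + s) N^2).
    The ratio of the first to the second is [gap_crit s]. *)
Lemma is_derive_elliptic_gap (s : R) :
  0 < s < 1 ->
  is_derive elliptic_gap s
    (legendre s * (1 - s) / (2 * (1 + s) * psi_num s ^ 2) * (1 - gap_crit s)).
Proof.
intros Hs.
assert (H1 := is_derive_ellK s Hs); assert (H2 := is_derive_ellK' s Hs).
assert (H3 := is_derive_psi_num s Hs); assert (H4 := is_derive_psi_den s Hs).
assert (HK := ellK_pos s Hs); assert (HN := psi_num_pos s Hs).
assert (H : forall (f1 f2 f3 f4 : R -> R) d1 d2 d3 d4,
  0 < f1 s -> 0 < f3 s ->
  is_derive f1 s d1 -> is_derive f2 s d2 -> is_derive f3 s d3 -> is_derive f4 s d4 ->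
  is_derive (fun x => f2 x / (2 * f1 x) - f4 x / (2 * f3 x)) s
    ((d2 * f1 s - f2 s * d1) / (2 * f1 s ^ 2) -
     (d4 * f3 s - f4 s * d3) / (2 * f3 s ^ 2))).
{ clear; intros f1 f2 f3 f4 d1 d2 d3 d4 P1 P3 H1 H2 H3 H4; auto_derive.
    repeat split; first [eexists; eassumption | lra].
  rewrite (is_derive_unique (fun x => f1 x) _ _ H1).
  rewrite (is_derive_unique (fun x => f2 x) _ _ H2).
  rewrite (is_derive_unique (fun x => f3 x) _ _ H3).
  rewrite (is_derive_unique (fun x => f4 x) _ _ H4); field; lra. }
apply (is_derive_eq _ _ _ _ (H _ _ _ _ _ _ _ _ HK HN H1 H2 H3 H4)).
unfold gap_crit, legendre, psi_den.
replace (ellE s) with (psi_num s + (1 - s) * ellK s) by (unfold psi_num; ring).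
field; repeat split; nra.
Qed.

Lemma is_derive_gap_crit (s : R) :
  0 < s < 1 ->
  is_derive gap_crit s
    (psi_num s * ((1 + s) * ellK s - ellE s) * (2 * ellE s - (1 - s ^ 2) * ellK s) /
     ((1 - s) ^ 3 * s ^ 2 * (1 + s) * ellK s ^ 3)).
Proof.
intros Hs.
assert (H1 := is_derive_ellK s Hs); assert (H3 := is_derive_psi_num s Hs).
assert (HK := ellK_pos s Hs).
assert (H : forall (f1 f3 : R -> R) d1 d3, 0 < f1 s ->
  is_derive f1 s d1 -> is_derive f3 s d3 ->
  is_derive (fun x => f3 x ^ 2 / ((1 - x) ^ 2 * x * f1 x ^ 2)) s
    (f3 s * (2 * d3 * (1 - s) * s * f1 s + f3 s * (2 * s * f1 s - (1 - s) * f1 s -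
      2 * (1 - s) * s * d1)) / ((1 - s) ^ 3 * s ^ 2 * f1 s ^ 3))).
{ clear - Hs; intros f1 f3 d1 d3 P1 H1 H3; auto_derive.
    repeat split; try (eexists; eassumption).
    apply Rgt_not_eq; repeat apply Rmult_lt_0_compat; lra.
  rewrite (is_derive_unique (fun x => f1 x) _ _ H1).
  rewrite (is_derive_unique (fun x => f3 x) _ _ H3); field; lra. }
apply (is_derive_eq _ _ _ _ (H _ _ _ _ HK H1 H3)).
unfold psi_num; field; repeat split; nra.
Qed.

(** Each factor of the derivative is positive: (1 + z) K > E because K > E, and 2E > (1 - z^2) K
    because E > (1 - z^2) K > 0. *)
Lemma gap_crit_incr (x y : R) : 0 < x -> x < y -> y < 1 -> gap_crit x < gap_crit y.
Proof.
intros Hx Hxy Hy.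
eapply (derive_pos_lt gap_crit); [ | | exact Hxy].
  intros z Hz; apply is_derive_gap_crit; lra.
intros z Hz; simpl.
assert (Hz1 : 0 < z < 1) by lra.
assert (HN := psi_num_pos z Hz1); assert (HK := ellK_pos z Hz1).
assert (H1 := ellE_lt_ellK z Hz1); assert (H2 := ellE_gt_compl_ellK z Hz1).
assert (0 < (1 - z ^ 2) * ellK z) by (apply Rmult_lt_0_compat; nra).
apply Rdiv_lt_0_compat.
  apply Rmult_lt_0_compat; [apply Rmult_lt_0_compat | ]; simpl in *; nra.
repeat apply Rmult_lt_0_compat; lra.
Qed.

Lemma elliptic_gap_incr (s0 x y : R) :
  gap_crit s0 = 1 -> s0 < 1 -> 0 < x -> x < y -> y <= s0 ->
  elliptic_gap x < elliptic_gap y.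
Proof.
intros H0 Hs0 Hx Hxy Hy.
eapply (derive_pos_lt elliptic_gap); [ | | exact Hxy].
  intros z Hz; apply is_derive_elliptic_gap; lra.
intros z Hz.
assert (Hz1 : 0 < z < 1) by lra.
assert (HN := psi_num_pos z Hz1); assert (HL := legendre_pos z Hz1).
assert (HP := gap_crit_incr z s0 ltac:(lra) ltac:(lra) Hs0).
apply Rmult_lt_0_compat; [ | lra].
apply Rdiv_lt_0_compat; [apply Rmult_lt_0_compat; lra | ].
apply Rmult_lt_0_compat; [lra | apply pow_lt, HN].
Qed.

Lemma elliptic_gap_decr (s0 x y : R) :
  gap_crit s0 = 1 -> 0 < s0 -> s0 <= x -> x < y -> y < 1 ->
  elliptic_gap y < elliptic_gap x.
Proof.
intros H0 Hs0 Hx Hxy Hy.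
apply Ropp_lt_cancel.
eapply (derive_pos_lt (fun s => - elliptic_gap s)); [ | | exact Hxy].
  intros z Hz; apply: is_derive_opp; apply is_derive_elliptic_gap; lra.
intros z Hz.
assert (Hz1 : 0 < z < 1) by lra.
assert (HN := psi_num_pos z Hz1); assert (HL := legendre_pos z Hz1).
assert (HP := gap_crit_incr s0 z Hs0 ltac:(lra) ltac:(lra)).
refine (Ropp_gt_lt_0_contravar _ _).
rewrite Rmult_comm; apply Rmult_neg_pos; [lra | ].
apply Rdiv_lt_0_compat; [apply Rmult_lt_0_compat; lra | ].
apply Rmult_lt_0_compat; [lra | apply pow_lt, HN].
Qed.

(** * Behaviour near s = 1, and the modulus where F vanishes *)

Definition period_ratio (s : R) : R := ellK' s / ellK s.

Lemma period_ratio_pos (s : R) : 0 < s < 1 -> 0 < period_ratio s.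
Proof.
intros Hs; apply Rdiv_lt_0_compat; [apply ellK'_pos | apply ellK_pos]; exact Hs.
Qed.

Lemma period_ratio_landen (s : R) :
  0 < s < 1 -> period_ratio (landen s) = period_ratio s / 2.
Proof.
intros Hs; unfold period_ratio.
rewrite (ellK'_landen s Hs) (ellK_landen s Hs).
assert (HK := ellK_pos s Hs); field; lra.
Qed.

Lemma period_ratio_decr (x y : R) :
  0 < x -> x < y -> y < 1 -> period_ratio y < period_ratio x.
Proof.
intros Hx Hxy Hy.
apply Ropp_lt_cancel.
eapply (derive_pos_lt (fun s => - period_ratio s)); [ | | exact Hxy].
  intros z Hz; assert (Hz1 : 0 < z < 1) by lra.
  apply: is_derive_opp; apply: is_derive_div.
  - apply is_derive_ellK', Hz1.
  - apply is_derive_ellK, Hz1.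
  - apply Rgt_not_eq, ellK_pos, Hz1.
intros z Hz; change opp with Ropp.
assert (Hz1 : 0 < z < 1) by lra.
assert (HK := ellK_pos z Hz1); assert (HL := legendre_pos z Hz1).
assert (Hz2 : 0 < 1 - z ^ 2) by nra.
apply (Rlt_le_trans _ (legendre z / (z * (1 - z ^ 2) * ellK z ^ 2))).
  apply Rdiv_lt_0_compat; [exact HL | ].
  repeat apply Rmult_lt_0_compat; lra.
right; unfold legendre; field; repeat split; lra.
Qed.

(** Iterating [landen] from 1/2 halves the ratio each time; monotonicity then extends the smallness
    to all larger moduli. *)
Lemma period_ratio_small (e : R) :
  0 < e -> exists s, 0 < s < 1 /\ period_ratio s < e.
Proof.
intros He.
assert (H : forall n, exists s, 0 < s < 1 /\
  period_ratio s = period_ratio (1 / 2) * (1 / 2) ^ n).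
{ induction n as [ | n [s [Hs IH]]].
    exists (1 / 2); simpl; lra.
  exists (landen s); split; [apply landen_range, Hs | ].
  rewrite (period_ratio_landen s Hs) IH; simpl; field. }
assert (H0 := period_ratio_pos (1 / 2) ltac:(lra)).
destruct (pow_lt_1_zero (1 / 2)) with (y := e / period_ratio (1 / 2)) as [N HN].
- rewrite Rabs_pos_eq; lra.
- apply Rdiv_lt_0_compat; lra.
- destruct (H N) as [s [Hs Hp]]; exists s; split; [exact Hs | rewrite Hp].
  specialize (HN N (le_n N)).
  rewrite Rabs_pos_eq in HN; [ | apply pow_le; lra].
  apply (Rmult_lt_compat_l (period_ratio (1 / 2))) in HN; [ | exact H0].
  replace (period_ratio (1 / 2) * (e / period_ratio (1 / 2))) with e in HN
    by (field; lra).
  exact HN.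
Qed.

(** Both terms of the gap end up between 0 and e/2: K'/K becomes small, and so does D/N, because D
    tends to 0 while N stays above N(1/2). *)
Lemma elliptic_gap_limit (e : R) :
  0 < e -> exists s1, 0 < s1 < 1 /\
  forall s, s1 < s < 1 -> Rabs (elliptic_gap s) < e.
Proof.
intros He.
destruct (period_ratio_small e He) as [a [Ha Hpa]].
assert (HN := psi_num_pos (1 / 2) ltac:(lra)).
destruct (psi_den_small (e * psi_num (1 / 2))) as [b [Hb Hdb]].
  apply Rmult_lt_0_compat; lra.
exists (Rmax a b); split.
  split; [apply (Rlt_le_trans _ a); [lra | apply Rmax_l] | apply Rmax_lub_lt; lra].
intros s [Hs1 Hs2].
assert (Has : a < s) by (apply (Rle_lt_trans _ (Rmax a b)); [apply Rmax_l | lra]).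
assert (Hbs : b < s) by (apply (Rle_lt_trans _ (Rmax a b)); [apply Rmax_r | lra]).
assert (Hs : 0 < s < 1) by lra.
assert (H1 := period_ratio_decr a s ltac:(lra) Has Hs2).
assert (H2 := psi_den_decr b s ltac:(lra) Hbs Hs2).
assert (H3 := psi_num_incr (1 / 2) s ltac:(lra) ltac:(lra) Hs2).
assert (H4 := period_ratio_pos s Hs); assert (H5 := psi_den_pos s Hs).
assert (HK := ellK_pos s Hs).
assert (H6 : 0 < psi_den s / psi_num s) by (apply Rdiv_lt_0_compat; lra).
assert (H7 : psi_den s / psi_num s < e).
{ apply (Rmult_lt_reg_r (psi_num s)); [lra | ].
  unfold Rdiv; rewrite Rmult_assoc Rinv_l; [nra | lra]. }
replace (elliptic_gap s) with (period_ratio s / 2 - psi_den s / psi_num s / 2)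
  by (unfold elliptic_gap, period_ratio; field; lra).
apply Rabs_def1; lra.
Qed.

(* The modulus with K' / K = 2: its Landen image 1 / sqrt 2 is self-complementary. *)
Definition square_modulus : R := (sqrt 2 - 1) ^ 2.

Lemma square_modulus_landen :
  0 < square_modulus < 1 /\ landen square_modulus = / sqrt 2 /\
  cmod (/ sqrt 2) = / sqrt 2.
Proof.
assert (H2 := pow2_sqrt 2 ltac:(lra)).
assert (Hl : 1 < sqrt 2) by (rewrite <- sqrt_1 at 1; apply sqrt_lt_1_alt; lra).
assert (Hu : sqrt 2 < 2) by nra.
unfold square_modulus; split; [split; nra | split].
- unfold landen; rewrite sqrt_pow2; [ | lra].
  set (q := sqrt 2) in *.
  replace (1 + (q - 1) ^ 2) with (2 * q * (q - 1)) by nra.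
  field; lra.
- unfold cmod; replace (1 - (/ sqrt 2) ^ 2) with ((/ sqrt 2) ^ 2).
    apply sqrt_pow2, Rlt_le, Rinv_0_lt_compat; lra.
  rewrite pow_inv H2; lra.
Qed.

(** At the self-complementary image K' = K and E' = E, so the Landen formulas express K' and E' at
    this modulus through K and E at the same modulus. *)
Lemma square_modulus_values :
  ellK' square_modulus = 2 * ellK square_modulus /\
  psi_den square_modulus = 2 * psi_num square_modulus.
Proof.
destruct square_modulus_landen as [Hk [Hl Hc]].
assert (H1 := ellK_landen _ Hk); assert (H2 := ellE_landen _ Hk).
assert (H3 := ellK'_landen _ Hk); assert (H4 := ellE'_landen _ Hk).
unfold psi_den, psi_num.
assert (HKl : ellK' (landen square_modulus) = ellK (landen square_modulus))
  by (unfold ellK'; rewrite Hl Hc; reflexivity).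
assert (HEl : ellE' (landen square_modulus) = ellE (landen square_modulus))
  by (unfold ellE'; rewrite Hl Hc; reflexivity).
rewrite HKl H1 in H3; rewrite HKl HEl H1 H2 in H4.
rewrite H3 H4.
(* This is 4k/(1 + k)^2 = 1/2 in polynomial form. Here D = 2E - (1 + 4k - k^2) K, and D = 2N amounts
   to this quadratic. *)
assert (Hq : square_modulus ^ 2 = 6 * square_modulus - 1).
{ unfold square_modulus; assert (Hs := pow2_sqrt 2 ltac:(lra)).
  set (q := sqrt 2) in *.
  replace (((q - 1) ^ 2) ^ 2) with ((q ^ 2 - 2 * q + 1) ^ 2) by ring.
  replace ((q - 1) ^ 2) with (q ^ 2 - 2 * q + 1) by ring.
  rewrite Hs; ring_simplify; rewrite Hs; ring. }
set (k := square_modulus) in *.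
split; [field; lra | ].
field_simplify; [ | lra..].
rewrite Hq; field_simplify; try lra.
Qed.

Lemma elliptic_gap_square_modulus : elliptic_gap square_modulus = 0.
Proof.
destruct square_modulus_values as [H1 H2].
destruct square_modulus_landen as [Hk _].
assert (HK := ellK_pos _ Hk); assert (HN := psi_num_pos _ Hk).
unfold elliptic_gap; rewrite H1 H2; field; lra.
Qed.

Lemma psi_square_modulus : psi square_modulus = 1.
Proof.
destruct square_modulus_values as [_ H2].
destruct square_modulus_landen as [Hk _].
assert (HN := psi_num_pos _ Hk).
rewrite psi_eq H2; field; lra.
Qed.

(** * Numerical location of the maximum *)

(** The bounds hold over an interval of c, since Landen images are irrational and are known only
    between decimals. For E'/K' and K'/(pi/2) a Landen step is rational and free of pi. *)
Definition compl_bounds (cl ch el eh kl kh : R) : Prop :=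
  forall c, cl <= c <= ch ->
    el <= ellE' c / ellK' c <= eh /\ kl <= ellK' c / (PI / 2) <= kh.

(** From c^2 K' < E' < K' and E' <= pi/2 <= K' follow c^2 <= E'/K' <= 1 and 1 <= K'/(pi/2) <= 1/c^2,
    which is sharp when c is close to 1. *)
Lemma compl_bounds_base (cl ch el kh : R) :
  0 < cl -> ch < 1 -> el <= cl ^ 2 -> 1 <= kh * cl ^ 2 ->
  compl_bounds cl ch el 1 1 kh.
Proof.
intros Hl Hh He Hk c Hc.
assert (Hc1 : 0 < c < 1) by lra.
assert (HPI := PI_RGT_0).
assert (H1 := ellE'_lt_ellK' c Hc1); assert (H2 := ellE'_gt c Hc1).
assert (HK := ellK'_pos c Hc1).
assert (H3 : ellE' c <= PI / 2) by (apply ellE_le_PI2, cmod_range, Hc1).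
assert (H4 : PI / 2 <= ellK' c) by (apply ellK_ge_PI2, cmod_range, Hc1).
assert (H5 : cl ^ 2 * ellK' c <= ellE' c).
{ assert (cl ^ 2 * ellK' c <= c ^ 2 * ellK' c)
    by (apply Rmult_le_compat_r; [lra | apply pow_incr; lra]).
  lra. }
repeat split.
- apply (Rle_trans _ (cl ^ 2)); [exact He | apply -> Rle_div_r; lra].
- apply <- Rle_div_l; lra.
- apply -> Rle_div_r; lra.
- apply <- Rle_div_l; [ | lra].
  assert (Hkp : 0 < kh).
  { assert (0 < cl ^ 2) by (apply pow_lt; lra).
    destruct (Rle_lt_dec kh 0); [nra | trivial]. }
  apply (Rle_trans _ (kh * cl ^ 2 * ellK' c)).
    rewrite <- (Rmult_1_l (ellK' c)) at 1; apply Rmult_le_compat_r; lra.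
  rewrite Rmult_assoc; apply Rmult_le_compat_l; lra.
Qed.

(** The squared form of Landen's map, 4x/(1 + x)^2, is increasing; stating the hypotheses in squares
    leaves only rational inequalities to check. *)
Lemma landen_bounds (cl c ch c1l c1h : R) :
  0 < cl -> cl <= c <= ch -> ch < 1 -> 0 <= c1l -> 0 <= c1h ->
  c1l ^ 2 * (1 + cl) ^ 2 <= 4 * cl -> 4 * ch <= c1h ^ 2 * (1 + ch) ^ 2 ->
  c1l <= landen c <= c1h.
Proof.
intros Hl Hc Hh Hl1 Hh1 HL HH.
assert (Hc1 : 0 < c < 1) by lra.
assert (Hr := landen_range c Hc1).
assert (Hq := landen_sq c ltac:(lra)).
assert (Hm : forall x y, 0 < x -> x <= y -> y < 1 ->
  4 * x / (1 + x) ^ 2 <= 4 * y / (1 + y) ^ 2).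
{ intros x y Hx Hxy Hy.
  apply <- Rle_div_l; [ | apply pow_lt; lra].
  replace (4 * y / (1 + y) ^ 2 * (1 + x) ^ 2)
    with (4 * y * (1 + x) ^ 2 / (1 + y) ^ 2) by (field; lra).
  apply -> Rle_div_r; [ | apply pow_lt; lra].
  (* This product is y (1 + x)^2 - x (1 + y)^2. *)
  assert (0 <= (y - x) * (1 - x * y)) by (apply Rmult_le_pos; nra).
  nra. }
assert (H1 := Hm cl c Hl (proj1 Hc) (proj2 Hc1)).
assert (H2 := Hm c ch (proj1 Hc1) (proj2 Hc) Hh).
apply Rle_div_r in HL; [ | apply pow_lt; lra].
apply Rle_div_l in HH; [ | apply pow_lt; lra].
assert (Hsl : c1l ^ 2 <= landen c ^ 2) by lra.
assert (Hsh : landen c ^ 2 <= c1h ^ 2) by lra.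
split; apply Rsqr_incr_0; try lra; rewrite !Rsqr_pow2; assumption.
Qed.

Lemma compl_bounds_step (c1l c1h e1l e1h k1l k1h cl ch el eh kl kh : R) :
  compl_bounds c1l c1h e1l e1h k1l k1h ->
  0 < cl -> ch < 1 -> 0 <= c1l -> 0 <= c1h ->
  c1l ^ 2 * (1 + cl) ^ 2 <= 4 * cl -> 4 * ch <= c1h ^ 2 * (1 + ch) ^ 2 ->
  0 <= e1l -> 0 <= e1h -> 0 <= kl -> 0 <= kh ->
  el <= (1 + cl) ^ 2 * e1l / 2 - ch -> (1 + ch) ^ 2 * e1h / 2 - cl <= eh ->
  kl * (1 + ch) <= 2 * k1l -> 2 * k1h <= kh * (1 + cl) ->
  compl_bounds cl ch el eh kl kh.
Proof.
intros H1 Hl Hh Hl1 Hh1 HL HH Hel Heh Hkl Hkh Hel' Heh' Hkl' Hkh' c Hc.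
assert (Hc1 : 0 < c < 1) by lra.
assert (HPI := PI_RGT_0).
assert (Hlc := landen_range c Hc1).
destruct (H1 _ (landen_bounds cl c ch c1l c1h Hl Hc Hh Hl1 Hh1 HL HH))
  as [[E1 E2] [K1 K2]].
assert (HK := ellK'_pos _ Hlc).
replace (ellE' c / ellK' c)
  with ((1 + c) ^ 2 * (ellE' (landen c) / ellK' (landen c)) / 2 - c).
2: { rewrite (ellK'_landen c Hc1) (ellE'_landen c Hc1); field; lra. }
replace (ellK' c / (PI / 2))
  with (2 * (ellK' (landen c) / (PI / 2)) / (1 + c)).
2: { rewrite (ellK'_landen c Hc1); field; lra. }
set (e := ellE' _ / _) in *; set (k := ellK' _ / _) in *.
assert (P1 : (1 + cl) ^ 2 <= (1 + c) ^ 2) by (apply pow_incr; lra).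
assert (P2 : (1 + c) ^ 2 <= (1 + ch) ^ 2) by (apply pow_incr; lra).
assert (P0 : 0 <= (1 + cl) ^ 2) by apply pow2_ge_0.
assert (Q1 : (1 + cl) ^ 2 * e1l <= (1 + c) ^ 2 * e)
  by (apply Rmult_le_compat; lra).
assert (Q2 : (1 + c) ^ 2 * e <= (1 + ch) ^ 2 * e1h)
  by (apply Rmult_le_compat; lra).
assert (Q3 : kl * (1 + c) <= kl * (1 + ch)) by (apply Rmult_le_compat_l; lra).
assert (Q4 : kh * (1 + cl) <= kh * (1 + c)) by (apply Rmult_le_compat_l; lra).
repeat split; try lra.
- apply -> Rle_div_r; lra.
- apply <- Rle_div_l; lra.
Qed.

Lemma cmod_cmod (s : R) : 0 < s < 1 -> cmod (cmod s) = s.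
Proof.
intros Hs; unfold cmod at 1; rewrite (cmod_sq s Hs).
replace (1 - (1 - s ^ 2)) with (s ^ 2) by ring; apply sqrt_pow2; lra.
Qed.

(** E and K at s are E' and K' at s', so a table around s' bounds them; squares keep the root in s'
    out of the hypotheses. *)
Lemma elliptic_bounds (cl ch el eh kl kh s : R) :
  compl_bounds cl ch el eh kl kh -> 0 < s < 1 -> 0 <= cl -> 0 <= ch ->
  cl ^ 2 <= 1 - s ^ 2 -> 1 - s ^ 2 <= ch ^ 2 ->
  el <= ellE s / ellK s <= eh /\ kl <= ellK s / (PI / 2) <= kh.
Proof.
intros H Hs Hl Hh Hl2 Hh2.
assert (Hc := cmod_range s Hs); assert (Hc2 := cmod_sq s Hs).
assert (Hb : cl <= cmod s <= ch)
  by (split; apply Rsqr_incr_0; try lra; rewrite !Rsqr_pow2; lra).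
specialize (H _ Hb); unfold ellE', ellK' in H; rewrite (cmod_cmod s Hs) in H.
exact H.
Qed.

Lemma gap_crit_ratio (s : R) :
  0 < s < 1 ->
  gap_crit s = (ellE s / ellK s - (1 - s)) ^ 2 / ((1 - s) ^ 2 * s).
Proof.
intros Hs; assert (HK := ellK_pos s Hs).
unfold gap_crit, psi_num; field; repeat split; lra.
Qed.

(** The defining quotient, cleared of its denominator and divided by pi/2, in the quantities that
    the tables enclose. *)
Lemma psi_ratio (s : R) :
  0 < s < 1 ->
  psi s * (ellK' s / (PI / 2) * (ellE' s / ellK' s - s)) =
  2 * (ellK s / (PI / 2) * (ellE s / ellK s - (1 - s))).
Proof.
intros Hs; assert (HK := ellK_pos s Hs); assert (HK' := ellK'_pos s Hs).
assert (HPI := PI_RGT_0); assert (HD := psi_den_pos s Hs).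
rewrite psi_eq; unfold psi_num, psi_den in *; field; repeat split; lra.
Qed.

Lemma psi_ge (s el kl eh kh q : R) :
  0 < s < 1 -> el <= ellE s / ellK s -> kl <= ellK s / (PI / 2) ->
  ellE' s / ellK' s <= eh -> ellK' s / (PI / 2) <= kh ->
  0 <= kl -> 1 - s <= el ->
  q * (kh * (eh - s)) <= 2 * (kl * (el - (1 - s))) -> q <= psi s.
Proof.
intros Hs H1 H2 H3 H4 Hkl Hel Hq.
assert (Hp := psi_pos s Hs); assert (He := psi_ratio s Hs).
assert (HD := psi_den_pos s Hs); assert (HK' := ellK'_pos s Hs).
assert (HPI := PI_RGT_0).
assert (Hk : 0 < ellK' s / (PI / 2)) by (apply Rdiv_lt_0_compat; lra).
assert (Hd : 0 < ellE' s / ellK' s - s).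
{ replace (ellE' s / ellK' s - s) with (psi_den s / ellK' s)
    by (unfold psi_den; field; lra).
  apply Rdiv_lt_0_compat; lra. }
assert (I1 : kl * (el - (1 - s)) <= ellK s / (PI / 2) * (ellE s / ellK s - (1 - s)))
  by (apply Rmult_le_compat; lra).
assert (I2 : ellK' s / (PI / 2) * (ellE' s / ellK' s - s) <= kh * (eh - s))
  by (apply Rmult_le_compat; lra).
assert (I3 := Rmult_lt_0_compat _ _ Hk Hd).
apply (Rmult_le_reg_r (kh * (eh - s))); [lra | ].
apply (Rmult_le_compat_l (psi s)) in I2; lra.
Qed.

Lemma psi_le (s eh kh el kl q : R) :
  0 < s < 1 -> ellE s / ellK s <= eh -> ellK s / (PI / 2) <= kh ->
  el <= ellE' s / ellK' s -> kl <= ellK' s / (PI / 2) ->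
  0 < kl -> s < el ->
  2 * (kh * (eh - (1 - s))) <= q * (kl * (el - s)) -> psi s <= q.
Proof.
intros Hs H1 H2 H3 H4 Hkl Hel Hq.
assert (Hp := psi_pos s Hs); assert (He := psi_ratio s Hs).
assert (HN := psi_num_pos s Hs); assert (HK := ellK_pos s Hs).
assert (HPI := PI_RGT_0).
assert (Hk : 0 < ellK s / (PI / 2)) by (apply Rdiv_lt_0_compat; lra).
assert (Hd : 0 < ellE s / ellK s - (1 - s)).
{ replace (ellE s / ellK s - (1 - s)) with (psi_num s / ellK s)
    by (unfold psi_num; field; lra).
  apply Rdiv_lt_0_compat; lra. }
assert (I1 : ellK s / (PI / 2) * (ellE s / ellK s - (1 - s)) <= kh * (eh - (1 - s)))
  by (apply Rmult_le_compat; lra).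
assert (I2 : kl * (el - s) <= ellK' s / (PI / 2) * (ellE' s / ellK' s - s))
  by (apply Rmult_le_compat; lra).
assert (I3 : 0 < kl * (el - s)) by (apply Rmult_lt_0_compat; lra).
apply (Rmult_le_reg_r (kl * (el - s))); [exact I3 | ].
apply (Rmult_le_compat_l (psi s)) in I2; lra.
Qed.

(* The two points enclose the critical modulus s0 = 0.4790472671... Writing c1 for the Landen
   image of c, the tables run
     K'(c) = 2 K'(c1) / (1+c)   and   (E'/K')(c) = (1+c)^2 (E'/K')(c1) / 2 - c
   back from a c close to 1, starting at c = s' (A) and at c = s (B). *)
Lemma lower_bracket : gap_crit 0.479047255 < 1 /\ 8.246385 <= psi 0.479047255.
Proof.
(* Near 1 a Landen step sends 1 - c to about (1 - c)^2/8. Three steps from s' come within 1e-12 of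
   1; s, being smaller, takes four. *)
assert (A3 : compl_bounds 0.999999999999 0.99999999999999
    0.999999999998 1 1 1.000000000003)
  by (apply compl_bounds_base; lra).
assert (A2 : compl_bounds 0.999999436952 0.999999436953
    0.999999436947 0.999999436955 1.000000281523 1.000000281528)
  by (apply (compl_bounds_step _ _ _ _ _ _ _ _ _ _ _ _ A3); lra).
assert (A1 : compl_bounds 0.997879897885 0.997879897886
    0.99788102158 0.9978810216 1.001061457779 1.001061457785)
  by (apply (compl_bounds_step _ _ _ _ _ _ _ _ _ _ _ _ A2); lra).
assert (A0 : compl_bounds 0.877789113327 0.877789113328
    0.881521007357 0.881521007396 1.066212867753 1.066212867761)
  by (apply (compl_bounds_step _ _ _ _ _ _ _ _ _ _ _ _ A1); lra).
assert (B4 : compl_bounds 0.999999999999 0.9999999999999999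
    0.999999999998 1 1 1.000000000003)
  by (apply compl_bounds_base; lra).
assert (B3 : compl_bounds 0.999999962436 0.999999962437
    0.999999962431 0.999999962439 1.000000018781 1.000000018786)
  by (apply (compl_bounds_step _ _ _ _ _ _ _ _ _ _ _ _ B4); lra).
assert (B2 : compl_bounds 0.999451965846 0.999451965847
    0.999452040918 0.999452040938 1.000274110968 1.000274110975)
  by (apply (compl_bounds_step _ _ _ _ _ _ _ _ _ _ _ _ B3); lra).
assert (B1 : compl_bounds 0.935916543135 0.935916543136
    0.936943074767 0.936943074808 1.033385570792 1.033385570801)
  by (apply (compl_bounds_step _ _ _ _ _ _ _ _ _ _ _ _ B2); lra).
assert (B0 : compl_bounds 0.479047255 0.479047255
    0.545772077339 0.545772077385 1.397366537544 1.397366537557)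
  by (apply (compl_bounds_step _ _ _ _ _ _ _ _ _ _ _ _ B1); lra).
assert (Hs : 0 < 0.479047255 < 1) by lra.
destruct (elliptic_bounds _ _ _ _ _ _ 0.479047255 A0 Hs) as [[E1 E2] [K1 K2]]; try lra.
destruct (B0 0.479047255) as [[E3 E4] [K3 K4]]; [lra | ].
split.
- rewrite (gap_crit_ratio _ Hs); apply -> Rdiv_lt_1; [ | lra].
  apply (Rle_lt_trans _ ((0.881521007396 - (1 - 0.479047255)) ^ 2)); [apply pow_incr | ]; lra.
- apply (psi_ge _ _ _ _ _ _ Hs E1 K1 E4 K4); lra.
Qed.

Lemma upper_bracket : 1 < gap_crit 0.4790473 /\ psi 0.4790473 <= 8.246395.
Proof.
assert (A3 : compl_bounds 0.999999999999 0.99999999999999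
    0.999999999998 1 1 1.000000000003)
  by (apply compl_bounds_base; lra).
assert (A2 : compl_bounds 0.999999436952 0.999999436953
    0.999999436947 0.999999436955 1.000000281523 1.000000281528)
  by (apply (compl_bounds_step _ _ _ _ _ _ _ _ _ _ _ _ A3); lra).
assert (A1 : compl_bounds 0.997879896977 0.997879896978
    0.997881020674 0.997881020694 1.001061458234 1.00106145824)
  by (apply (compl_bounds_step _ _ _ _ _ _ _ _ _ _ _ _ A2); lra).
assert (A0 : compl_bounds 0.877789088769 0.87778908877
    0.881520984301 0.88152098434 1.066212882182 1.06621288219)
  by (apply (compl_bounds_step _ _ _ _ _ _ _ _ _ _ _ _ A1); lra).
assert (B4 : compl_bounds 0.999999999999 0.9999999999999999
    0.999999999998 1 1 1.000000000003)
  by (apply compl_bounds_base; lra).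
assert (B3 : compl_bounds 0.999999962436 0.999999962437
    0.999999962431 0.999999962439 1.000000018781 1.000000018786)
  by (apply (compl_bounds_step _ _ _ _ _ _ _ _ _ _ _ _ B4); lra).
assert (B2 : compl_bounds 0.99945196612 0.999451966121
    0.999452041192 0.999452041212 1.000274110831 1.000274110838)
  by (apply (compl_bounds_step _ _ _ _ _ _ _ _ _ _ _ _ B3); lra).
assert (B1 : compl_bounds 0.935916558618 0.935916558619
    0.936943089755 0.936943089796 1.033385562386 1.033385562395)
  by (apply (compl_bounds_step _ _ _ _ _ _ _ _ _ _ _ _ B2); lra).
assert (B0 : compl_bounds 0.4790473 0.4790473
    0.545772111093 0.545772111138 1.397366483662 1.397366483675)
  by (apply (compl_bounds_step _ _ _ _ _ _ _ _ _ _ _ _ B1); lra).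
assert (Hs : 0 < 0.4790473 < 1) by lra.
destruct (elliptic_bounds _ _ _ _ _ _ 0.4790473 A0 Hs) as [[E1 E2] [K1 K2]]; try lra.
destruct (B0 0.4790473) as [[E3 E4] [K3 K4]]; [lra | ].
split.
- rewrite (gap_crit_ratio _ Hs); apply -> Rlt_div_r; [ | lra].
  apply (Rlt_le_trans _ ((0.881520984301 - (1 - 0.4790473)) ^ 2)); [ | apply pow_incr]; lra.
- apply (psi_le _ _ _ _ _ _ Hs E2 K2 E3 K3); lra.
Qed.

(** The lower end lies nearer to s0 than the upper one: r0 exceeds the rounding limit 8.246385 by
    less than 2e-6, while 8.246395 leaves more room. *)
Lemma gap_crit_root :
  exists s0, 0.479047255 < s0 < 0.4790473 /\ gap_crit s0 = 1.
Proof.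
destruct lower_bracket as [HL _]; destruct upper_bracket as [HU _].
destruct (IVT_interv (fun s => gap_crit s - 1) 0.479047255 0.4790473)
  as [s [Hs H0]]; try lra.
  intros s Hs; apply continuity_pt_minus; [ | apply continuity_pt_const; easy].
  apply continuity_pt_filterlim, @ex_derive_continuous.
  eexists; apply is_derive_gap_crit; lra.
exists s; split; [ | lra].
(* The intermediate value theorem yields a closed interval; its endpoints are excluded because
   [gap_crit] differs from 1 there. *)
split; apply Rnot_le_lt; intros Hle.
- replace s with 0.479047255 in H0; lra.
- replace s with 0.4790473 in H0; lra.
Qed.

(** * The limit at infinity, the zero at 1, and the theorem *)

Lemma is_lim_f_mu : is_lim f_mu p_infty 0.
Proof.
apply is_lim_spec; intros e.
destruct (elliptic_gap_limit e (cond_pos e)) as [s1 [Hs1 H]].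
exists (psi s1); intros x Hx.
assert (Hx0 : 0 < x) by (assert (H0 := psi_pos s1 Hs1); lra).
destruct (psi_inv_spec x Hx0) as [Hs Hp].
rewrite Rminus_0_r (f_mu_eq x Hx0); apply H.
split; [apply psi_lt_inv; trivial; lra | lra].
Qed.

Lemma f_mu_1 : f_mu 1 = 0.
Proof.
rewrite f_mu_eq; [ | lra].
rewrite <- psi_square_modulus.
rewrite psi_inv_psi; [ | apply square_modulus_landen].
apply elliptic_gap_square_modulus.
Qed.

(* The decimal 8.24639 is read as rounded to five places (r0 = 8.246386...). *)
Theorem theorem4p2 :
  (exists r0 : R,
      Rabs (r0 - 824639 / 100000) <= 5 / 1000000 /\
      (forall x y : R, 0 < x -> x < y -> y < r0 -> f_mu x < f_mu y) /\
      (forall x y : R, r0 < x -> x < y -> f_mu y < f_mu x)) /\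
  is_lim f_mu p_infty 0 /\
  (forall r : R, 0 < r < 1 -> 1 / PI * mu (psi_inv r) < 1 / r) /\
  (forall r : R, 1 < r -> 1 / PI * mu (psi_inv r) > 1 / r).
Proof.
destruct gap_crit_root as [s0 [Hs0 H0]].
assert (Hs01 : 0 < s0 < 1) by lra.
assert (Hr0 := psi_pos s0 Hs01).
assert (Hlow : 8.246385 <= psi s0).
{ destruct lower_bracket as [_ H]; apply (Rle_trans _ _ _ H), Rlt_le, psi_incr; lra. }
assert (Hupp : psi s0 <= 8.246395).
{ destruct upper_bracket as [_ H]; apply (Rle_trans _ (psi 0.4790473)); [ | exact H].
  apply Rlt_le, psi_incr; lra. }
(* The point [psi s0] itself is included, which settles r = r0 in the last claim. *)
assert (Hinc : forall x y, 0 < x -> x < y -> y <= psi s0 -> f_mu x < f_mu y).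
{ intros x y Hx Hxy Hy.
  rewrite !f_mu_eq; try lra.
  destruct (psi_inv_spec x Hx) as [H1 H2].
  apply (elliptic_gap_incr s0); try lra; [apply psi_inv_incr; lra | ].
  destruct Hy as [Hy | ->]; [ | rewrite psi_inv_psi; lra].
  assert (Hi := psi_inv_incr y (psi s0) ltac:(lra) Hy).
  rewrite psi_inv_psi in Hi; lra. }
assert (Hdec : forall x y, psi s0 < x -> x < y -> f_mu y < f_mu x).
{ intros x y Hx Hxy.
  rewrite !f_mu_eq; try lra.
  destruct (psi_inv_spec y ltac:(lra)) as [H1 H2].
  apply (elliptic_gap_decr s0); try lra; [ | apply psi_inv_incr; lra].
  assert (Hi := psi_inv_incr (psi s0) x Hr0 Hx).
  rewrite psi_inv_psi in Hi; lra. }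
split; [ | split; [ | split]].
- exists (psi s0); split; [apply Rabs_le; lra | split; [ | exact Hdec]].
  intros x y Hx Hxy Hy; apply Hinc; lra.
- exact is_lim_f_mu.
- intros r Hr; assert (H := Hinc r 1 ltac:(lra) ltac:(lra) ltac:(lra)).
  rewrite f_mu_1 in H; unfold f_mu in H; lra.
- intros r Hr; enough (0 < f_mu r) by (unfold f_mu in *; lra).
  destruct (Rle_lt_dec r (psi s0)) as [Hle | Hlt].
    rewrite <- f_mu_1; apply Hinc; lra.
  (* Decrease to the limit 0 gives only a weak inequality; applying it at r + 1 and using f(r) > f(r
     + 1) makes it strict at r. *)
  assert (Hnext := Hdec r (r + 1) Hlt ltac:(lra)).
  enough (0 <= f_mu (r + 1)) by lra.
  change (Rbar_le 0 (f_mu (r + 1))).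
  apply (is_lim_le_loc f_mu (fun _ => f_mu (r + 1)) p_infty);
    [ | exact is_lim_f_mu | apply is_lim_const].
  exists (r + 1); intros x Hx; apply Rlt_le, Hdec; lra.
Qed.
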